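(* Let $G$ be a finite simple connected graph with universal covering $\varphi:\widehat{G}\to G$, and let $\Gamma$ be the group of $\varphi$-preserving automorphisms of $\widehat{G}$. Let $A$ and $B$ be finite alphabets, let $\psi=(\psi_v)_{v\in V(\widehat{G})}$ be a $\Gamma$-invariant potential on $\widehat{G}$ (with alphabet $A$) having a unique Gibbs measure $\nu$ on $A^{V(\widehat{G})}$, let $\tau:A^{V(\widehat{G})}\to B^{V(\widehat{G})}$ be a $\Gamma$-equivariant measurable map, and let $\mu=\tau(\nu)$ be the push-forward of $\nu$. Let $\mu_v$ ($v\in V(G)$) and $\mu_e$ ($e\in E(G)$) be the vertex and edge marginals of $\mu$. Then $$\sum_{v\in V(G)}(\deg(v)-1)\,\mathcal{H}(\mu_v)\le\sum_{e\in E(G)}\mathcal{H}(\mu_e).$$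
   Context: Universal covering: fix a vertex of $G$; the vertices of the tree $\widehat{G}$ are the non-backtracking paths in $G$ starting from it (including the trivial one), two being adjacent iff one is the other extended by one edge; $\varphi:V(\widehat{G})\to V(G)$ sends a path to its endpoint, and it is extended to edges. This is unique up to isomorphism. $\Gamma=\{\gamma\in\operatorname{Aut}(\widehat{G}):\varphi(\gamma v)=\varphi(v)\text{ for all }v\in V(\widehat{G})\}$. $\Gamma$ acts on $A^{V(\widehat{G})}$ and on $B^{V(\widehat{G})}$ by $(\gamma\omega)(v)=\omega(\gamma^{-1}v)$; $\tau$ is $\Gamma$-equivariant if $\tau(\gamma\omega)=\gamma(\tau(\omega))$ for all $\gamma\in\Gamma$ and $\omega$. A potential on a locally finite graph $H$ is a collection $(\psi_v)_{v\in V(H)}$ of functions $\psi_v:A^{\operatorname{Ball}(v,D)}\to\mathbb{R}$, where $D$ is a fixed positive integer (the memory); $\psi_v$ is also regarded as a function on $A^W$ for any $W\supset\operatorname{Ball}(v,D)$. A potential on $\widehat{G}$ is $\Gamma$-invariant if $\psi_{\gamma v}(\gamma\omega)=\psi_v(\omega)$ for all $v\in V(\widehat{G})$, $\gamma\in\Gamma$, $\omega\in A^{V(\widehat{G})}$. For $W\subset V(H)$, $\operatorname{pr}_W:A^{V(H)}\to A^W$ is the projection and $\partial^rW$ is the set of vertices outside $W$ at distance at most $r$ from $W$; $s\sqcup t$ is the gluing of configurations on disjoint sets. A Borel probability measure $\nu$ on $A^{V(H)}$ is a Gibbs measure for $\psi$ if for every finite $\Lambda\subset V(H)$, $s\in A^\Lambda$,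 $t\in A^{\partial^{2D}\Lambda}$ (with conditioning event of positive probability), $$\Pr\big(\operatorname{pr}_\Lambda(\omega)=s\,\big|\,\operatorname{pr}_{\partial^{2D}\Lambda}(\omega)=t\big)=\frac{\exp\big(-\sum_{v\in\Lambda\cup\partial^D\Lambda}\psi_v(s\sqcup t)\big)}{\sum_{s'\in A^\Lambda}\exp\big(-\sum_{v\in\Lambda\cup\partial^D\Lambda}\psi_v(s'\sqcup t)\big)},$$ where $\omega$ is distributed according to $\nu$; for finite $H$ this is the measure $\nu(\{\omega\})=\exp(-\sum_{v}\psi_v(\omega))/Z$. The unique Gibbs measure of a $\Gamma$-invariant potential is $\Gamma$-invariant, hence so is $\mu$. Marginals: for $v\in V(G)$, $\mu_v$ is the law on $B$ of $x(v')$, where $x$ is $\mu$-distributed and $v'$ is any vertex with $\varphi(v')=v$. For $e=\{u,v\}\in E(G)$, $\mu_e$ is the law on $B^{\{u,v\}}=B\times B$ of $(x(u'),x(v'))$, where $\{u',v'\}\in E(\widehat{G})$ is any edge with $\varphi(u')=u$, $\varphi(v')=v$. By $\Gamma$-invariance these do not depend on the choice of lifts. $\mathcal{H}(\eta)=-\sum_q\eta(\{q\})\log\eta(\{q\})$ (with $0\log0=0$) is Shannon entropy. *)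

(* Defs.v *)
From HB Require Import structures.
From mathcomp Require Import all_boot all_order all_algebra finmap.
From mathcomp Require Import all_classical all_reals all_analysis.

Set Implicit Arguments.
Unset Strict Implicit.
Unset Printing Implicit Defensive.

Import Order.TTheory GRing.Theory Num.Theory.
Local Open Scope ring_scope.

(* Nonemptiness of an alphabet is recorded by a distinguished letter, as
   measurable types must be pointed.  There is no probability measure on
   A^W, and no map A^W -> B^W, when the target alphabet is empty (and W is
   not). *)
#[short(type="alphabetType")]
HB.structure Definition Alphabet := {T of Finite T & Pointed T}.

(* Finite simple graphs are given by symmetric irreflexive relations on a finType. *)

Section FiniteGraph.
Context (V : finType) (e : rel V).

Definition degree (v : V) : nat := #|[set u | e v u]|.

Definition edges : {set {set V}} :=
  [set E : {set V} | [exists u, exists v, e u v && (E == [set u; v])]].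

End FiniteGraph.

(* s_i != s_(i+2) for all i. *)
Fixpoint nonbacktracking (T : eqType) (s : seq T) : bool :=
  if s is x :: s' then
    (if s' is _ :: z :: _ then x != z else true) && nonbacktracking s'
  else true.

Section UniversalCover.
Context (V : finType) (e : rel V) (o : V).

(* The path o :: p is represented by its tail p. *)
Definition ucover : Type :=
  {p : seq V | path e o p && nonbacktracking (o :: p)}.
HB.instance Definition _ := Countable.on ucover.
HB.instance Definition _ := SubType.on ucover.

Definition uadj : rel ucover := fun p q =>
  [exists x : V, val q == rcons (val p) x] ||
  [exists x : V, val p == rcons (val q) x].

Definition uproj (p : ucover) : V := last o (val p).

Record deck : Type := Deck {
  deck_fun :> ucover -> ucover;
  deck_inv : ucover -> ucover;
  deck_funK : cancel deck_fun deck_inv;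
  deck_invK : cancel deck_inv deck_fun;
  deck_adj : forall p q, uadj (deck_fun p) (deck_fun q) = uadj p q;
  deck_proj : forall p, uproj (deck_fun p) = uproj p
}.

End UniversalCover.

Local Open Scope classical_set_scope.

(* A^W with the Borel sigma-algebra of the product of discrete topologies. *)
Definition config (W : choiceType) (A : alphabetType) : Type :=
  g_sigma_algebraType (@open (prod_topology (fun _ : W => discrete_topology A))).
HB.instance Definition _ (W : choiceType) (A : alphabetType) :=
  Measurable.on (config W A).

Section Gibbs.
Context (R : realType) (W : choiceType) (adj : rel W) (A : alphabetType).

Definition Ball (D : nat) (v : W) : set W :=
  [set u | exists p : seq W, [/\ path adj v p, last v p = u & (size p <= D)%N]].

Definition bdry (r : nat) (X : set W) : set W :=
  [set u | ~ X u /\ exists2 w, X w & Ball r w u].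

Definition pr (X : set W) (w : W -> A) : X -> A := fun u => w (set_val u).

Definition potential (D : nat) : Type := forall v : W, (Ball D v -> A) -> R.

Definition pot_at D (psi : potential D) (v : W) (w : W -> A) : R :=
  psi v (pr w).

(* The gluing of s and t, padded by a fixed letter outside their domains in
   order to be a total configuration. *)
Definition glue_config (L : {fset W}) (X : set W) (s : {ffun L -> A})
    (t : X -> A) : W -> A :=
  fun v => if insub v is Some u then s u
           else if insub v is Some u then t u else point.

(* For v in L or bdry D L, Ball D v is included in the union of L and
   bdry (2 * D) L: the padding in glue_config is not seen by the potential. *)
Definition weight D (psi : potential D) (L : {fset W}) (s : {ffun L -> A})
    (t : bdry (2 * D) [set` L] -> A) : R :=
  expR (- \sum_(v \in [set` L] `|` bdry D [set` L])
            pot_at psi v (glue_config s t)).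

Definition is_gibbs D (psi : potential D) (nu : probability (config W A) R) :
    Prop :=
  forall (L : {fset W}) (s : {ffun L -> A}) (t : bdry (2 * D) [set` L] -> A),
    let S := [set w : config W A | [ffun u : L => w (val u)] = s] in
    let T := [set w : config W A | pr w = t] in
    (0 < nu T)%E ->
    fine (nu (S `&` T)) / fine (nu T) =
    weight psi s t / \sum_(s' : {ffun L -> A}) weight psi s' t.

Definition is_unique_gibbs D (psi : potential D)
    (nu : probability (config W A) R) : Prop :=
  is_gibbs psi nu /\
  forall nu' : probability (config W A) R, is_gibbs psi nu' ->
    forall X, measurable X -> nu' X = nu X.

(* Point masses of the law of one coordinate, and of a pair of coordinates. *)
Definition vertex_law (m : set (config W A) -> \bar R) (v : W) (a : A) : R :=
  fine (m [set w | w v = a]).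

Definition edge_law (m : set (config W A) -> \bar R) (u v : W) (c : A * A) : R :=
  fine (m [set w | w u = c.1 /\ w v = c.2]).

End Gibbs.

Definition entropy (R : realType) (Q : finType) (p : Q -> R) : R :=
  - \sum_(q : Q) p q * ln (p q).

Section Equivariance.
Context (V : finType) (e : rel V) (o : V).

Definition act (A : alphabetType) (g : deck e o) (w : config (ucover e o) A) :
    config (ucover e o) A :=
  fun v => w (deck_inv g v).

Definition invariant_potential (R : realType) (A : alphabetType) D
    (psi : potential R (@uadj V e o) A D) : Prop :=
  forall (g : deck e o) (v : ucover e o) (w : config (ucover e o) A),
    pot_at psi (g v) (act g w) = pot_at psi v w.

Definition equivariant (A B : alphabetType)
    (tau : config (ucover e o) A -> config (ucover e o) B) : Prop :=
  forall (g : deck e o) (w : config (ucover e o) A),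
    tau (act g w) = act g (tau w).

End Equivariance.

(* Main.v *)
Require Import Defs.
From HB Require Import structures.
From mathcomp Require Import fingroup perm action.
From mathcomp Require Import all_boot all_order all_algebra finmap.
From mathcomp Require Import all_classical all_reals all_analysis.
From mathcomp Require Import ring lra.

Set Implicit Arguments.
Unset Strict Implicit.
Unset Printing Implicit Defensive.

Import Order.TTheory GRing.Theory Num.Theory.
Local Open Scope ring_scope.

(** The inequality is a first-moment bound over random coverings of the graph.

   Fix one orientation of every edge and write [s E], [t E] for the ends of the
   edge [E].  Summing over edges instead of vertices turns the claim into
   0 <= sum_v H(mu_v) + sum_E (H(mu_E) - H(mu_(s E)) - H(mu_(t E))).

   Counting.  Take a finite covering of the graph, glue [n] copies of it along
   arbitrary permutations of the [n] copies, one for each oriented edge of the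
   covering, and label all the vertices by letters of [B].  For given types
   (letter counts) of the labels above each vertex and of the pairs of labels
   above each edge, the number of labellings is a product of multinomials, and
   for each of them the number of gluings of an edge is at most
   n! |class of the edge| / (|class of its source| |class of its target|)
   ([card_links_mul]).  To exponential precision, the number of pairs (gluing,
   labelling) with given types is therefore (number of gluings) times
   exp n(sum_v H + sum_E (H - H - H)).  There are polynomially many types, so if
   every gluing admits a labelling with prescribed statistics, the exponent is
   at least -o(1) for some such statistics ([lift_counting]).

   Existence.  It remains to find, for every gluing, a labelling whose
   statistics are close to the marginals of [mu].  The initial covering is
   chosen such that paths of bounded length in the tree stay distinct in it and
   hence in all its gluings: its fibre is the group of permutations of the
   short non-backtracking paths, on which the edges of the graph act by partial
   steps ([voltage_inj]).  The invariant potential descends to each of these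
   finite graphs, and large balls of the tree embed in them; the Gibbs weights
   of the finite graph, conditioned on the outside of such a ball, agree with
   the conditional weights on the tree ([lift_heat_bath]).  Uniqueness of [nu]
   says that, in large balls, these conditional weights give every local event
   nearly its [nu]-probability, uniformly in the boundary condition
   ([unique_uniform], a compactness argument).  So under the finite Gibbs weights
   the occurrences of a local event at two remote places are almost
   uncorrelated, and a second moment computation yields one configuration with
   nearly the right frequencies for finitely many local events
   ([good_config]).  The map [tau] is approximated by one that reads finitely
   many coordinates ([local_approximation]); applied around each vertex of the
   finite graph, it turns this configuration into the labelling that is needed
   ([good_labelling]).  Continuity of entropy concludes. *)

(** * Counting words by type *)

Section Factorials.
Context (R : realType).

(** Both bounds on factorials follow by induction from ln (1 + x) <= x, and
   are precise up to a term of order ln n, which is all that the counting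
   needs. *)
Lemma ln_fact_ge n : n%:R * ln n%:R - n%:R <= ln (n`!%:R) :> R.
Proof.
elim: n => [|[|n] IH]; first by rewrite fact0 ln1 mul0r subr0.
  by rewrite ln1 mulr0 sub0r oppr_le0.
rewrite factS natrM lnM ?posrE ?ltr0n ?fact_gt0//.
set m : R := n.+1%:R in IH *; have m0 : 0 < m by rewrite ltr0n.
have -> : n.+2%:R = m + 1 :> R by rewrite -natr1.
have : ln (1 + m^-1) <= m^-1 by apply: le_ln1Dx; apply: lt_trans (ltrN10 _) _;
  rewrite invr_gt0.
have -> : 1 + m^-1 = (m + 1) / m by field; rewrite gt_eqF.
rewrite ln_div ?posrE ?addr_gt0// => h.
have : m * (ln (m + 1) - ln m) <= m / m by rewrite ler_wpM2l// ltW.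
rewrite divff ?gt_eqF//.
lra.
Qed.

Lemma ln_fact_le k : ln (k`!%:R) <= k%:R * ln k%:R - k%:R + 1 + ln k%:R :> R.
Proof.
elim: k => [|[|k] IH]; first by rewrite fact0 ln1 mul0r ln0// subr0 add0r addr0.
  by rewrite ln1 mulr0 sub0r addNr addr0.
rewrite factS natrM lnM ?posrE ?ltr0n ?fact_gt0//.
set m : R := k.+1%:R in IH *; have m0 : 0 < m by rewrite ltr0n.
have -> : k.+2%:R = m + 1 :> R by rewrite -natr1.
have m1 : 0 < m + 1 by rewrite addr_gt0.
have : ln (1 + - (m + 1)^-1) <= - (m + 1)^-1.
  by apply: le_ln1Dx; rewrite ltrN2 invf_lt1// ltrDr.
have -> : 1 - (m + 1)^-1 = m / (m + 1) by field; rewrite gt_eqF.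
rewrite ln_div ?posrE// => h.
have : (m + 1) * (ln m - ln (m + 1)) <= (m + 1) * - (m + 1)^-1.
  by rewrite ler_wpM2l// ltW.
rewrite mulrN divff ?gt_eqF//.
lra.
Qed.

Lemma ln_natprod (I : finType) (F : I -> nat) : (forall i, 0 < F i)%N ->
  ln ((\prod_i F i)%:R) = \sum_i ln (F i)%:R :> R.
Proof.
move=> F0; have lnP : forall x y : nat, (0 < x)%N -> (0 < y)%N ->
    ln (x * y)%:R = ln x%:R + ln y%:R :> R.
  by move=> x y x0 y0; rewrite natrM lnM ?posrE ?ltr0n.
elim: (index_enum I) => [|i s IH]; first by rewrite !big_nil ln1.
by rewrite !big_cons lnP ?IH// prodn_gt0.
Qed.

End Factorials.

Section Types.
Context (R : realType) (n : nat) (Q : finType).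
Implicit Types z : {ffun 'I_n -> Q}.

Definition occ z (q : Q) : nat := #|[set i | z i == q]|.

(** The type of a word in the sense of the method of types. Counts are stored
   in ['I_n.+1] in order that types form a finite type, with polynomially many
   elements in [n]. *)
Definition type_of z : {ffun Q -> 'I_n.+1} := [ffun q => inord (occ z q)].

Definition type_class (t : {ffun Q -> 'I_n.+1}) := [set z | type_of z == t].

Definition freq z (q : Q) : R := (occ z q)%:R / n%:R.

Lemma occ_le z q : (occ z q <= n)%N.
Proof. by rewrite -[leqRHS]card_ord max_card. Qed.

Lemma type_ofP z z' : type_of z = type_of z' <-> occ z =1 occ z'.
Proof.
split=> [/ffunP h q|h]; last by apply/ffunP => q; rewrite !ffunE h.
by have := h q; rewrite !ffunE => /(congr1 val); rewrite /= !inordK// ltnS occ_le.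
Qed.

Lemma sum_occ z : (\sum_q occ z q = n)%N.
Proof.
rewrite -[RHS]card_ord -sum1_card (partition_big z xpredT) //=.
by apply: eq_bigr => q _; rewrite sum1_card /occ; apply: eq_card => i; rewrite !inE.
Qed.

Lemma sum_by_value z (f : Q -> R) : \sum_i f (z i) = \sum_q (occ z q)%:R * f q.
Proof.
rewrite (partition_big z xpredT) //=; apply: eq_bigr => q _.
rewrite (eq_bigr (fun _ => f q)) => [|i /eqP <- //].
rewrite sumr_const mulr_natl /occ; congr (_ *+ _).
by apply: eq_card => i; rewrite !inE.
Qed.

Lemma freq_ge0 z q : 0 <= freq z q. Proof. by rewrite divr_ge0. Qed.

Lemma occ_pos z i : (0 < occ z (z i))%N.
Proof. by apply/card_gt0P; exists i; rewrite inE. Qed.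

Hypothesis n_gt0 : (0 < n)%N.
Let n0 : (0 : R) < n%:R. Proof. by rewrite ltr0n. Qed.

Lemma sum_freq z : \sum_q freq z q = 1.
Proof. by rewrite -mulr_suml -natr_sum sum_occ divff// gt_eqF. Qed.

Lemma entropy_freq z : n%:R * entropy (freq z) = - \sum_i ln (freq z (z i)).
Proof.
rewrite (sum_by_value z (fun q => ln (freq z q))) mulrN mulr_sumr; congr (- _).
by apply: eq_bigr => q _; rewrite mulrA [n%:R * _]mulrC divfK// gt_eqF.
Qed.

(** Under the product measure with marginals [freq z], every word of the class
   has mass exp (- n H), and the total mass is 1. *)
Lemma ln_class_le z : ln (#|type_class (type_of z)|%:R) <= n%:R * entropy (freq z).
Proof.
pose P (z' : {ffun 'I_n -> Q}) : R := \prod_i freq z (z' i).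
have total : \sum_z' P z' = 1.
  rewrite -(bigA_distr_bigA (fun _ q => freq z q)) big1// => i _.
  exact: sum_freq.
have PE z' : z' \in type_class (type_of z) -> P z' = expR (- (n%:R * entropy (freq z))).
  rewrite inE => /eqP/type_ofP z'z.
  have -> : P z' = \prod_i expR (ln (freq z (z' i))).
    apply: eq_bigr => i _; rewrite lnK// posrE divr_gt0// ltr0n.
    by rewrite -z'z occ_pos.
  rewrite -expR_sum entropy_freq opprK; congr expR.
  rewrite (sum_by_value z' (fun q => ln (freq z q))).
  rewrite (sum_by_value z (fun q => ln (freq z q))).
  by apply: eq_bigr => q _; rewrite z'z.
have c0 : (0 : R) < #|type_class (type_of z)|%:R.
  by rewrite ltr0n; apply/card_gt0P; exists z; rewrite inE.
rewrite -[leRHS]expRK ler_ln ?posrE ?expR_gt0//.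
have : #|type_class (type_of z)|%:R * expR (- (n%:R * entropy (freq z))) <= 1.
  rewrite mulr_natl -sumr_const.
  apply: (@le_trans _ _ (\sum_z' P z')); last by rewrite total.
  rewrite [leRHS](bigID (mem (type_class (type_of z)))) /=.
  rewrite -(eq_bigr _ PE).
  by rewrite lerDl sumr_ge0// => z' _; rewrite prodr_ge0// => i _; exact: freq_ge0.
by rewrite expRN ler_pdivrMr ?expR_gt0// mul1r.
Qed.

Definition permute z (s : {perm 'I_n}) : {ffun 'I_n -> Q} := [ffun i => z (s i)].

Lemma occ_permute z s : occ (permute z s) =1 occ z.
Proof.
move=> q; rewrite /occ -[RHS](card_preimset _ (@perm_inj _ s)).
by apply: eq_card => i; rewrite !inE ffunE.
Qed.

Lemma type_of_permute z s : type_of (permute z s) = type_of z.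
Proof. by apply/type_ofP; exact: occ_permute. Qed.

Lemma type_of_eq_permute z z' : type_of z = type_of z' -> exists s, z' = permute z s.
Proof.
move=> /type_ofP zz'.
have cE (y : {ffun 'I_n -> Q}) q : count_mem q [tuple y i | i < n] = occ y q.
  rewrite /= count_map /occ cardE -size_filter.
  by congr size; rewrite enumT /enum_mem -enumT; apply: eq_filter => i; rewrite !inE.
have : perm_eq [tuple z' i | i < n] [tuple z i | i < n].
  by apply/allP => q _; rewrite /= !cE zz'.
move=> /tuple_permP[s sE]; exists s; apply/ffunP => i; rewrite ffunE.
have /(congr1 (fun t => tnth t i)) : [tuple z' i | i < n] =
    [tuple tnth [tuple z i | i < n] (s i) | i < n] by exact: val_inj.
by rewrite !tnth_mktuple.
Qed.

(** The permutations fixing [z] in the action of the symmetric group by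
   rearrangement, whose orbits are the type classes. *)
Definition stab z : {set {perm 'I_n}} := [set s | permute z s == z].

(** A permutation that fixes [z] preserves the level sets of [z], and is
   determined by its restrictions to them. *)
Lemma card_stab z : (#|stab z| <= \prod_q (occ z q)`!)%N.
Proof.
pose blk q := [set i | z i == q].
pose F (s : {perm 'I_n}) : {ffun Q -> {perm 'I_n}} := [ffun q => restr_perm (blk q) s].
have blkN s q : s \in stab z -> s \in 'N(blk q | 'P)%g.
  rewrite inE => /eqP/ffunP sz; apply/astabsP => i.
  by rewrite !inE /= /aperm -[z i]sz ffunE.
have Finj : {in stab z &, injective F}.
  move=> s s' sz s'z /ffunP FF; apply/perm.permP => i.
  have := FF (z i); rewrite !ffunE => /(congr1 (fun f : {perm 'I_n} => f i)).
  by rewrite !restr_permE ?blkN// inE.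
rewrite -(card_in_imset Finj).
apply: (@leq_trans #|family (fun q => perm_on (blk q))|).
  apply/subset_leq_card/fintype.subsetP => _ /imsetP[s sz ->].
  by apply/familyP => q; rewrite ffunE; exact: restr_perm_on.
rewrite card_family foldrE big_map -big_enum /=.
by rewrite leq_prod// => q _; rewrite card_perm.
Qed.

(** The nonempty fibres of [permute z] are translates of the stabilizer. *)
Lemma card_class_stab z : (n`! <= #|type_class (type_of z)| * #|stab z|)%N.
Proof.
have -> : n`! = #|{perm 'I_n}| by rewrite -card_Sn; apply: eq_card => s; rewrite !inE.
have -> : #|{perm 'I_n}| =
    (\sum_(z' in type_class (type_of z)) \sum_(s | permute z s == z') 1)%N.
  rewrite -sum1_card.
  rewrite (partition_big (permute z) (fun z' => z' \in type_class (type_of z))) //.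
  by move=> s _; rewrite inE type_of_permute.
rewrite -sum_nat_const leq_sum// => z' _; rewrite sum1_card.
have [s0 /eqP zs0|none] := pickP [pred s | permute z s == z']; last first.
  by rewrite (eq_card0 (A := [pred s | permute z s == z'])).
rewrite -(card_imset _ (mulgI s0^-1)%g); apply/subset_leq_card/fintype.subsetP.
move=> y /imsetP[s sP ->]; have zs : permute z s = z' by apply/eqP; exact: sP.
rewrite inE; apply/eqP/ffunP => i.
have /ffunP/(_ ((s0^-1)%g i)) : permute z s = permute z s0 by rewrite zs zs0.
by rewrite !ffunE permM permKV.
Qed.

(** The class is an orbit of the symmetric group with stabilizer of order at
   most the product of the factorials of the letter counts; Stirling bounds do
   the rest. *)
Lemma ln_class_ge z :
  n%:R * entropy (freq z) - #|Q|%:R * (1 + ln n%:R) <= ln (#|type_class (type_of z)|%:R).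
Proof.
set c := #|type_class _|.
have c0 : (0 : R) < c%:R.
  by rewrite ltr0n; apply/card_gt0P; exists z; rewrite inE.
have nc : (n`! <= c * \prod_q (occ z q)`!)%N.
  by apply: leq_trans (card_class_stab z) _; rewrite leq_mul2l card_stab orbT.
have P0 : (0 : R) < (\prod_q (occ z q)`!)%:R.
  by rewrite ltr0n prodn_gt0// => q; exact: fact_gt0.
have Pn0 : (0 < \prod_q (occ z q)`!)%N by rewrite prodn_gt0// => q; exact: fact_gt0.
have le1 : ln (n`!%:R) <= ln (c%:R : R) + \sum_q ln ((occ z q)`!%:R).
  rewrite -ln_natprod; last by move=> q; exact: fact_gt0.
  by rewrite -lnM ?posrE// -natrM ler_ln ?posrE ?ltr0n ?fact_gt0 ?muln_gt0 -?(ltr0n R)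
    ?c0// ler_nat.
have le2 : \sum_q ln ((occ z q)`!%:R) <= \sum_q
    ((occ z q)%:R * ln (occ z q)%:R - (occ z q)%:R + 1 + ln n%:R : R).
  apply: ler_sum => q _; apply: le_trans (ln_fact_le R _) _; rewrite lerD2l.
  have [->|o0] := posnP (occ z q); first by rewrite ln0// ln_ge0// ler1n.
  by rewrite ler_ln ?posrE ?ltr0n// ler_nat occ_le.
have nH : n%:R * entropy (freq z) = n%:R * ln n%:R - \sum_q (occ z q)%:R * ln (occ z q)%:R.
  have -> : n%:R * ln n%:R = \sum_q (occ z q)%:R * ln n%:R :> R.
    by rewrite -mulr_suml -natr_sum sum_occ.
  rewrite /entropy mulrN mulr_sumr -sumrN -sumrB; apply: eq_bigr => q _;
    rewrite mulrA [n%:R * _]mulrC divfK ?gt_eqF//.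
  have [->|o0] := posnP (occ z q); first by rewrite !mul0r subr0 oppr0.
  by rewrite ln_div ?posrE ?ltr0n//; ring.
have sumE : \sum_q ((occ z q)%:R * ln (occ z q)%:R - (occ z q)%:R + 1 + ln n%:R : R) =
    \sum_q (occ z q)%:R * ln (occ z q)%:R - n%:R + #|Q|%:R * (1 + ln n%:R).
  under eq_bigr do rewrite -addrA.
  rewrite big_split /= sumr_const mulr_natl; congr (_ + _).
  by rewrite sumrB -natr_sum sum_occ.
rewrite sumE in le2; have := ln_fact_ge R n; lra.
Qed.

End Types.

Section EdgeCounting.
Context (n : nat) (B : finType).
Implicit Types (f g : {ffun 'I_n -> B}) (s p : {perm 'I_n}).

Definition pairing f s g : {ffun 'I_n -> B * B} := [ffun i => (f i, g (s i))].

(** The ways to match the positions of [f] with those of [g] that produce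
   pairs of letters in given proportions. *)
Definition links f g t : {set {perm 'I_n}} := [set s | type_of (pairing f s g) == t].

(** Rearranging [f] and [g] conjugates the matchings; so the number of them
   depends only on the types of [f] and [g]. *)
Lemma card_links_permute f g p p' t :
  #|links (permute f p) (permute g p') t| = #|links f g t|.
Proof.
have inj : injective (fun s => (p^-1 * s * p')%g) by move=> s s' /mulIg/mulgI.
rewrite -[RHS](card_preimset _ inj); apply: eq_card => s; rewrite !inE.
rewrite -(type_of_permute (pairing f _ g) p); congr (type_of _ == t).
by apply/ffunP => i; rewrite !ffunE !permM permK.
Qed.

(** Double counting of the triples (matching, rearrangement of [f],
   rearrangement of [g]) with pairs of type [t]. The two words can be read off
   from the matching and the word of pairs, which leaves n! choices for the
   former and a type class for the latter; and all pairs of words contribute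
   equally. *)
Lemma card_links_mul f g t :
  (#|links f g t| * #|type_class (type_of f)| * #|type_class (type_of g)| <=
   n`! * #|type_class t|)%N.
Proof.
have -> : n`! = #|{perm 'I_n}| by rewrite -card_Sn; apply: eq_card => s; rewrite !inE.
pose S := [set u : {perm 'I_n} * ({ffun 'I_n -> B} * {ffun 'I_n -> B}) |
  [&& u.2.1 \in type_class (type_of f), u.2.2 \in type_class (type_of g) &
      u.1 \in links u.2.1 u.2.2 t]].
apply: (@leq_trans #|S|).
  rewrite -mulnA [(#|links f g t| * _)%N]mulnC -cardsX -sum_nat_const.
  rewrite -[X in (_ <= X)%N]sum1_card.
  rewrite (partition_big snd (fun fg =>
    fg \in finset.setX (type_class (type_of f)) (type_class (type_of g)))) /=; last first.
    by move=> [s [f' g']]; rewrite !inE /= => /and3P[-> ->].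
  apply: leq_sum => -[f' g']; rewrite !inE /= => /andP[/eqP ff' /eqP gg'].
  have [p f'E] := type_of_eq_permute (esym ff'); have [p' g'E] :=
    type_of_eq_permute (esym gg').
  rewrite -(card_links_permute f g p p') -f'E -g'E sum1_card.
  have inj : injective (fun s => (s, (f', g')) : {perm 'I_n} * ({ffun 'I_n ->
    B} * {ffun 'I_n -> B})).
    by move=> s s' [].
  rewrite -(card_imset _ inj); apply/subset_leq_card/fintype.subsetP.
  move=> y /imsetP[s sl ->]; apply/andP; split; last exact: eqxx.
  by rewrite inE /= sl !inE ff' gg' !eqxx.
pose h (u : {perm 'I_n} * ({ffun 'I_n -> B} * {ffun 'I_n -> B})) := (u.1,
  pairing u.2.1 u.1 u.2.2).
have hinj : injective h.
  move=> [s [f1 g1]] [s' [f2 g2]] [<- /ffunP E]; congr (_, (_, _)); apply/ffunP => i.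
    by have := E i; rewrite !ffunE => -[].
  by have := E (s^-1 i)%g; rewrite !ffunE permKV => -[].
rewrite -(card_imset _ hinj) -cardsT -cardsX; apply/subset_leq_card/fintype.subsetP.
move=> _ /imsetP[[s [f1 g1]] + ->]; rewrite !inE /= => /and3P[_ _].
by [].
Qed.

End EdgeCounting.

(** * The first-moment bound for glued copies of a graph *)

Section LiftCounting.
Context (R : realType) (U Ed B : finType) (src tgt : Ed -> U) (n : nat).
Hypothesis n_gt0 : (0 < n)%N.
Local Notation labelling := {ffun U -> {ffun 'I_n -> B}}.
Local Notation gluing := {ffun Ed -> {perm 'I_n}}.
Implicit Types (y : labelling) (s : gluing).

Definition edge_pairing s y (E : Ed) : {ffun 'I_n -> B * B} :=
  pairing (y (src E)) (s E) (y (tgt E)).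

Local Notation types :=
  ({ffun U -> {ffun B -> 'I_n.+1}} * {ffun Ed -> {ffun B * B -> 'I_n.+1}})%type.

Definition types_of s y : types :=
  ([ffun u => type_of (y u)], [ffun E => type_of (edge_pairing s y E)]).

Lemma pigeonhole (S T : finType) (t0 : T) (f : S -> T) :
  exists t, (#|S| <= #|T| * #|[set x | f x == t]|)%N.
Proof.
exists [arg max_(t > t0) #|[set x | f x == t]|].
case: arg_maxnP => // t _ tmax.
rewrite -[X in (X <= _)%N]sum1_card (partition_big f xpredT) //= -sum_nat_const.
apply: leq_sum => t' _; rewrite sum1_card; apply: leq_trans (tmax t' isT).
by rewrite [leqRHS](_ : _ = #|[pred x | f x == t']|)//; apply: eq_card => x; rewrite !inE.
Qed.

Lemma card_family_prod (I : finType) (T : finType) (F : I -> {set T}) :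
  #|[set h : {ffun I -> T} | [forall i, h i \in F i]]| = (\prod_i #|F i|)%N.
Proof.
transitivity #|family F|.
  by apply: eq_card => h; rewrite inE; apply/forallP/familyP.
by rewrite card_family foldrE big_map -big_enum.
Qed.

(** The labelling chosen for a gluing lies in a product of type classes; once
   it is fixed, the edges constrain their permutations independently of each
   other. *)
Lemma card_types_class (ys : gluing -> labelling) s0 :
  (#|[set s | types_of s (ys s) == types_of s0 (ys s0)]| <=
   \prod_u #|type_class (type_of (ys s0 u))| *
   \prod_E #|links (ys s0 (src E)) (ys s0 (tgt E))
                   (type_of (edge_pairing s0 (ys s0) E))|)%N.
Proof.
pose Y := [set y : labelling | [forall u, y u \in type_class (type_of (ys s0 u))]].
rewrite -card_family_prod -/Y -sum_nat_const.
rewrite -[X in (X <= _)%N]sum1_card (partition_big ys (fun y => y \in Y)) /=; last first.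
  move=> s; rewrite !inE => /eqP[/ffunP yt _]; apply/forallP => u; rewrite inE.
  by have := yt u; rewrite !ffunE => ->.
apply: leq_sum => y; rewrite inE => /forallP yY; rewrite sum1_card.
have linkE E : #|links (ys s0 (src E)) (ys s0 (tgt E)) (type_of (edge_pairing s0 (ys s0)
  E))|
    = #|links (y (src E)) (y (tgt E)) (type_of (edge_pairing s0 (ys s0) E))|.
  have ex u : exists p, y u = permute (ys s0 u) p.
    by have := yY u; rewrite inE => /eqP/esym/type_of_eq_permute.
  have [p ->] := ex (src E); have [p' ->] := ex (tgt E).
  by rewrite card_links_permute.
under eq_bigr do rewrite linkE.
rewrite -card_family_prod; apply/subset_leq_card/fintype.subsetP => s /andP[].
rewrite !inE => /eqP[_ /ffunP st] /eqP sy; apply/forallP => E; rewrite inE.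
by have := st E; rewrite !ffunE sy => <-.
Qed.

(** A bound for the degree in [n] of the polynomial factors lost in counting:
   the number of types, and the errors of Stirling's formula in two type classes
   for each edge. *)
Definition poly_degree : R := (#|U| * #|B| + #|Ed| * #|{: B * B}| + 2 * (#|Ed| * #|B|))%:R.

(** By the pigeonhole principle, one tuple of types serves a polynomially
   small proportion of all the gluings, while [card_types_class] bounds the
   number of gluings that it can serve. Taking logarithms and bounding the
   classes by entropies gives the inequality. *)
Lemma lift_counting (good : gluing -> labelling -> Prop) :
  (forall s, exists y, good s y) ->
  exists s y, good s y /\
    0 <= n%:R * (\sum_u entropy (freq R (y u)) +
      \sum_E (entropy (freq R (edge_pairing s y E)) -
              entropy (freq R (y (src E))) - entropy (freq R (y (tgt E)))))
      + poly_degree * (1 + ln n.+1%:R).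
Proof.
move=> /choice[ys ysP].
have [t tP] := pigeonhole (types_of [ffun _ => 1%g] (ys [ffun _ => 1%g]))
  (fun s => types_of s (ys s)).
have S0 : (0 < #|gluing|)%N by apply/card_gt0P; exists [ffun _ => 1%g].
have [s0 s0t] : exists s0, types_of s0 (ys s0) = t.
  have : (0 < #|[set s | types_of s (ys s) == t]|)%N.
    by rewrite lt0n; apply: contraTneq (leq_trans S0 tP) => ->; rewrite muln0.
  by move=> /card_gt0P[s]; rewrite inE => /eqP; exists s.
exists s0, (ys s0); split=> //; set y := ys s0.
rewrite -s0t in tP; have := leq_trans tP (leq_mul (leqnn _) (card_types_class ys s0)).
rewrite -/y {tP}.
set A := fun u => #|type_class (type_of (y u))|.
set N := fun E => #|links (y (src E)) (y (tgt E)) (type_of (edge_pairing s0 y E))|.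
have A0 u : (0 < A u)%N by apply/card_gt0P; exists (y u); rewrite inE.
have N0 E : (0 < N E)%N by apply/card_gt0P; exists (s0 E); rewrite inE.
have T0 : (0 < #|{: types}|)%N by apply/card_gt0P; exists (types_of s0 y).
have cardn : #|{perm 'I_n}| = n`! by rewrite -card_Sn; apply: eq_card => s; rewrite !inE.
have cardT : #|{: types}| = (n.+1 ^ (#|U| * #|B| + #|Ed| * #|{: B * B}|))%N.
  have c (I J : finType) : #|{ffun I -> {ffun J -> 'I_n.+1}}| = (n.+1 ^ (#|I| * #|J|))%N.
    by rewrite card_ffun card_ffun card_ord -expnM mulnC.
  by rewrite expnD -!c -card_prod.
rewrite card_ffun cardn cardT => main.
have lnX (m k : nat) : (0 < m)%N -> ln (m ^ k)%:R = k%:R * ln m%:R :> R.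
  by move=> m0; rewrite natrX lnXn ?ltr0n// mulr_natl.
have lnM_nat (k m : nat) : (0 < k)%N -> (0 < m)%N -> ln (k * m)%:R = ln k%:R + ln m%:R :> R.
  by move=> k0 m0; rewrite natrM lnM ?posrE ?ltr0n.
have ln_mono (k m : nat) : (0 < k)%N -> (k <= m)%N -> ln k%:R <= ln m%:R :> R.
  by move=> k0 km; rewrite ler_ln ?posrE ?ltr0n ?ler_nat// (leq_trans k0).
have Npos : (0 < \prod_E N E)%N by rewrite prodn_gt0.
have Apos : (0 < \prod_u A u)%N by rewrite prodn_gt0.
have := ln_mono _ _ _ main; rewrite expn_gt0 fact_gt0 => /(_ isT).
rewrite lnX ?fact_gt0// !lnM_nat ?muln_gt0 ?expn_gt0 ?Apos ?Npos// lnX// !ln_natprod//.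
have sumA : \sum_u ln (A u)%:R <= \sum_u n%:R * entropy (freq R (y u)).
  by apply: ler_sum => u _; exact: ln_class_le.
have sumN : \sum_E ln (N E)%:R <= \sum_E (ln n`!%:R +
    n%:R * (entropy (freq R (edge_pairing s0 y E)) -
      entropy (freq R (y (src E))) - entropy (freq R (y (tgt E)))) +
    2 * #|B|%:R * (1 + ln n%:R)).
  apply: ler_sum => E _.
  have := card_links_mul (y (src E)) (y (tgt E)) (type_of (edge_pairing s0 y E)).
  rewrite -/(N E) -/(A (src E)) -/(A (tgt E)).
  set Ae := #|type_class _| => NA.
  have Ae0 : (0 < Ae)%N.
    by apply/card_gt0P; exists (edge_pairing s0 y E); rewrite inE.
  have := ln_mono _ _ _ NA; rewrite !muln_gt0 N0 !A0 => /(_ isT).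
  rewrite !lnM_nat ?muln_gt0 ?N0 ?A0 ?fact_gt0//.
  have := ln_class_le R n_gt0 (edge_pairing s0 y E); rewrite -/Ae.
  have := ln_class_ge R n_gt0 (y (src E)); rewrite -/(A (src E)).
  have := ln_class_ge R n_gt0 (y (tgt E)); rewrite -/(A (tgt E)).
  lra.
set HE := \sum_E (_ - _ - _ : R).
have {}sumN : \sum_E ln (N E)%:R <= #|Ed|%:R * ln n`!%:R + n%:R * HE +
    #|Ed|%:R * #|B|%:R * 2 * (1 + ln n%:R).
  apply: le_trans sumN _; rewrite big_split big_split /= -mulr_sumr !sumr_const.
  rewrite -/HE -/(#|Ed|).
  have constE (x : R) : x *+ #|Ed| = #|Ed|%:R * x by rewrite mulr_natl.
  rewrite (constE (ln _)) (constE (2 * _ * _)).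
  rewrite le_eqVlt; apply/orP; left; apply/eqP; ring.
have ln0n : 0 <= ln n%:R :> R by rewrite ln_ge0// ler1n.
have lnn1 : ln n%:R <= ln n.+1%:R :> R by apply: ln_mono.
rewrite /poly_degree ![(_ + _)%:R]natrD ![(_ * _)%:R]natrM.
move: sumA sumN; rewrite -mulr_sumr.
set kU : R := #|U|%:R * #|B|%:R; set kE : R := #|Ed|%:R * #|{: B * B}|%:R.
set k2 : R := #|Ed|%:R * #|B|%:R.
have kU0 : 0 <= kU by rewrite mulr_ge0.
have kE0 : 0 <= kE by rewrite mulr_ge0.
have k20 : 0 <= k2 by rewrite mulr_ge0.
have k2n : k2 * ln n%:R <= k2 * ln n.+1%:R by rewrite ler_wpM2l.
rewrite !mulrDr !mulrDl; lra.
Qed.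

End LiftCounting.

(** * Sums over the edges of a graph *)

Lemma set2_eq (V : finType) (a b c d : V) :
  [set a; b] = [set c; d] -> (a, b) = (c, d) \/ (a, b) = (d, c).
Proof.
move=> E; have aE : a \in [set c; d] by rewrite -E set21.
have cE : c \in [set a; b] by rewrite E set21.
have dE : d \in [set a; b] by rewrite E set22.
have bE : b \in [set c; d] by rewrite -E set22.
move: aE bE cE dE; rewrite !inE => /orP[]/eqP-> /orP[]/eqP->;
  rewrite ?eqxx ?orbb ?orbT; auto.
- by move=> _ /eqP->; left.
- by move=> /eqP->; left.
Qed.

(** Summing over ordered pairs of neighbours, an edge is met once from each
   end. *)
Lemma handshake (R : realType) (V : finType) (e : rel V) (h : V -> R)
    (s t : {set V} -> V) :
  symmetric e -> irreflexive e ->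
  (forall E, E \in edges e -> [set s E; t E] = E) ->
  \sum_v (degree e v)%:R * h v = \sum_(E in edges e) (h (s E) + h (t E)).
Proof.
move=> e_sym e_irr stE.
transitivity (\sum_(p : V * V | e p.1 p.2) h p.1).
  rewrite -(pair_big_dep xpredT (fun v u => e v u) (fun v _ => h v)) /=.
  apply: eq_bigr => v _; rewrite sumr_const mulr_natl /degree.
  by congr (_ *+ _); apply: eq_card => u; rewrite !inE.
rewrite (partition_big (fun p => [set p.1; p.2]) (mem (edges e))) /=; last first.
  move=> [v u] /= vu; rewrite inE; apply/existsP; exists v; apply/existsP; exists u.
  by rewrite vu eqxx.
apply: eq_bigr => E EP.
have st : e (s E) (t E).
  move: (EP); rewrite inE => /existsP[v /existsP[u /andP[vu /eqP Evu]]].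
  have := stE E EP; rewrite [X in _ = X]Evu => /set2_eq[[-> ->]|[-> ->]] //.
  by rewrite e_sym.
have neq : (t E, s E) != (s E, t E).
  by apply/eqP => -[ts _]; rewrite ts e_irr in st.
rewrite (bigD1 (s E, t E)) /=; last by rewrite st stE ?eqxx.
rewrite (bigD1 (t E, s E)) /=; last by rewrite e_sym st finset.setUC stE// eqxx.
rewrite big1 ?addr0// => -[v u] /= /andP[/andP[/andP[_ /eqP vuE] n1] n2].
by move: vuE; rewrite -{1}(stE E EP) => /set2_eq[] vu; rewrite vu eqxx in n1 n2.
Qed.

(** * The universal covering and its deck transformations *)

Section Cover.
Local Open Scope nat_scope.
Context (V : finType) (e : rel V) (o : V).
Hypothesis e_sym : symmetric e.
Local Notation T := (ucover e o).
Implicit Types p q : T.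

Lemma nonbacktracking_rcons2 (a : V) s y x :
  nonbacktracking (a :: rcons (rcons s y) x) =
  nonbacktracking (a :: rcons s y) && (last a s != x).
Proof.
elim: s a => [|b s IH] a /=; first by rewrite andbT.
have := IH b; case: s {IH} => [|c s] /=; first by move=> ->; rewrite andbT.
by move=> ->; rewrite andbA.
Qed.

Lemma nonbacktracking_rcons (a : V) s y :
  nonbacktracking (a :: rcons s y) -> nonbacktracking (a :: s).
Proof.
case/lastP: s => [|s z]; first by [].
by rewrite nonbacktracking_rcons2 => /andP[].
Qed.

(** Free reduction: stepping back along the last edge of a path cancels
   it. *)
Definition move (s : seq V) (x : V) : seq V :=
  if (s != [::]) && (last o (take (size s).-1 s) == x) then take (size s).-1 s
  else rcons s x.

Lemma move_rcons s y x :
  move (rcons s y) x = if last o s == x then s else rcons (rcons s y) x.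
Proof.
by rewrite /move size_rcons /= -cats1 take_size_cat// cats1; case: s.
Qed.

Definition reduced (s : seq V) := path e o s && nonbacktracking (o :: s).

Lemma reduced_rcons s y : reduced (rcons s y) -> reduced s /\ e (last o s) y.
Proof.
rewrite /reduced rcons_path => /andP[/andP[-> ->]] /nonbacktracking_rcons.
by move=> ->.
Qed.

Lemma move_reduced s x : reduced s -> e (last o s) x -> reduced (move s x).
Proof.
case/lastP: s => [|s y] rs; first by rewrite /reduced /= => ->.
rewrite move_rcons last_rcons => yx; have [rs' _] := reduced_rcons rs.
case: ifPn => // sx; rewrite /reduced rcons_path last_rcons yx.
by move: rs; rewrite /reduced nonbacktracking_rcons2 sx => /andP[-> ->].
Qed.

Lemma last_move s x : last o (move s x) = x.
Proof.
case/lastP: s => [|s y] //; rewrite move_rcons.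
by case: eqP => [->|_] //; rewrite last_rcons.
Qed.

Lemma moveK s x : reduced s -> move (move s x) (last o s) = s.
Proof.
case/lastP: s => [|s y] rs; first by rewrite /= (move_rcons [::]) /= eqxx.
rewrite move_rcons last_rcons; case: eqP => [sx|_]; last first.
  by rewrite move_rcons last_rcons eqxx.
case/lastP: s rs sx => [|s z]//; rewrite last_rcons => rs zx.
rewrite move_rcons; move: rs.
by rewrite /reduced nonbacktracking_rcons2 => /andP[_ /andP[_ /negPf ->]].
Qed.

(** The neighbour of [p] above [x], provided that [x] is adjacent to [uproj
   p]; only then is the moved path reduced and the default value of [insubd]
   avoided. *)
Definition ustep p x : T := insubd p (move (val p) x).

Lemma val_ustep p x : e (uproj p) x -> val (ustep p x) = move (val p) x.
Proof. by move=> px; apply: insubdK; exact: (move_reduced (valP p) px). Qed.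

Lemma uproj_ustep p x : e (uproj p) x -> uproj (ustep p x) = x.
Proof. by move=> px; rewrite /uproj val_ustep ?last_move. Qed.

Lemma ustepK p x : e (uproj p) x -> ustep (ustep p x) (uproj p) = p.
Proof.
move=> px; apply: val_inj; rewrite val_ustep; last first.
  by rewrite uproj_ustep// e_sym.
by rewrite val_ustep// moveK//; exact: valP.
Qed.

Lemma uadj_sym p q : uadj p q = uadj q p.
Proof. by rewrite /uadj orbC. Qed.

Lemma uadj_ustep p x : e (uproj p) x -> uadj p (ustep p x).
Proof.
move=> px; rewrite /uadj val_ustep//.
case/lastP: (val p) => [|s y].
  by apply/orP; left; apply/existsP; exists x.
rewrite move_rcons; case: ifP => _; apply/orP; [right|left]; apply/existsP.
  by exists y.
by exists x.
Qed.

(** A neighbour in the tree is determined by its projection: the projection is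
   a covering. *)
Lemma uadjP p q : uadj p q -> e (uproj p) (uproj q) /\ q = ustep p (uproj q).
Proof.
have half p' q' : [exists x, val q' == rcons (val p') x] ->
    e (uproj p') (uproj q') /\ q' = ustep p' (uproj q').
  move=> /existsP[x /eqP q'E]; have : reduced (val q') by exact: valP.
  rewrite q'E => rq; have [rp px] := reduced_rcons rq.
  have q'x : uproj q' = x by rewrite /uproj q'E last_rcons.
  rewrite q'x; split=> //; apply: val_inj; rewrite val_ustep// q'E.
  case/lastP: (val p') rq {rp px q'E} => [|s y] //.
  by rewrite move_rcons /reduced nonbacktracking_rcons2 => /andP[_] /andP[_ /negPf->].
case/orP => /half [] //.
by move=> qp pE; rewrite e_sym qp; split=> //; rewrite {1}pE ustepK.
Qed.

Definition uroot : T := Sub [::] isT.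

Lemma ucover_ind (P : T -> Prop) : P uroot ->
  (forall p x, e (uproj p) x -> P p -> P (ustep p x)) -> forall p, P p.
Proof.
move=> P0 PS p; have [s] := ubnP (size (val p)).
elim: s p => // s IH p; case/lastP pE : (val p) => [|r x].
  by move=> _; have -> : p = uroot by apply: val_inj.
rewrite size_rcons ltnS => rs.
have rp : reduced (rcons r x) by rewrite -pE; exact: valP.
have [rr rx] := reduced_rcons rp.
have -> : p = ustep (Sub r rr : T) x.
  apply: val_inj; rewrite val_ustep// pE /=.
  case/lastP: r rp {pE rs rr rx} => [|r y]//.
  by rewrite move_rcons /reduced nonbacktracking_rcons2 => /andP[_] /andP[_ /negPf->].
by apply: PS => //; apply: IH.
Qed.

(** For [c] above the base point, this is the deck transformation that moves
   the root to [c]: it follows the steps of [p] starting from [c] instead of the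
   root. *)
Definition translate (c p : T) : T := foldl ustep c (val p).

Lemma translate_rcons c p s y : val p = rcons s y ->
  exists2 q, val q = s & [/\ translate c p = ustep (translate c q) y, e (uproj q) y &
   ustep q y = p].
Proof.
move=> pE; have rp : reduced (rcons s y) by rewrite -pE; exact: valP.
have [rs sy] := reduced_rcons rp; exists (Sub s rs : T) => //.
rewrite /translate pE foldl_rcons; split=> //.
apply: val_inj; rewrite val_ustep// pE /=.
case/lastP: s rp {pE rs sy} => [|r z]//.
by rewrite move_rcons /reduced nonbacktracking_rcons2 => /andP[_] /andP[_ /negPf->].
Qed.

Lemma uproj_translate c p : uproj c = o -> uproj (translate c p) = uproj p.
Proof.
move=> co; have [s] := ubnP (size (val p)).
elim: s p => // s IH p; case/lastP pE : (val p) => [|r x].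
  by move=> _; rewrite /translate /uproj pE.
rewrite size_rcons ltnS => rs; have [q qE [-> qx <-]] := translate_rcons c pE.
by rewrite !uproj_ustep// IH// qE.
Qed.

Lemma translate_ustep c p x : uproj c = o -> e (uproj p) x ->
  translate c (ustep p x) = ustep (translate c p) x.
Proof.
move=> co px; case/lastP pE : (val p) => [|s y].
  by rewrite /translate val_ustep// pE.
have [q qE [-> qy qp]] := translate_rcons c pE.
have [sx|sx] := eqVneq (last o s) x.
  have qx : uproj q = x by rewrite /uproj qE.
  have -> : ustep p x = q by rewrite -qp -qx ustepK.
  by rewrite -qx -(uproj_translate q co) ustepK// uproj_translate.
rewrite /translate val_ustep// pE move_rcons (negPf sx) !foldl_rcons.
by rewrite -qE.
Qed.

Lemma translate_trans p q : uproj p = uproj q ->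
  exists2 c, uproj c = o & translate c p = q.
Proof.
elim/ucover_ind: p q => [|p x px IH] q pq; first by exists q.
move: pq; rewrite uproj_ustep// => xq.
have qp : e (uproj q) (uproj p) by rewrite -xq e_sym.
have [|c co cp] := IH (ustep q (uproj p)); first by rewrite uproj_ustep.
by exists c => //; rewrite translate_ustep// cp xq ustepK.
Qed.

Lemma translateM c d p : uproj c = o -> uproj d = o ->
  translate c (translate d p) = translate (translate c d) p.
Proof.
move=> co do_; have cd : uproj (translate c d) = o by rewrite uproj_translate.
elim/ucover_ind: p => [|p x px IH] //.
by rewrite !translate_ustep ?uproj_translate// IH.
Qed.

Lemma translate1 p : translate uroot p = p.
Proof.
by elim/ucover_ind: p => [|p x px IH] //; rewrite translate_ustep// IH.
Qed.

Lemma translate_inv c : uproj c = o -> exists d,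
  [/\ uproj d = o, cancel (translate c) (translate d) &
      cancel (translate d) (translate c)].
Proof.
move=> co; have [//|d do_ dc] := @translate_trans c uroot.
have [//|c' c'o c'd] := @translate_trans d uroot.
have dcK : cancel (translate c) (translate d).
  by move=> p; rewrite translateM// dc translate1.
have c'dK : cancel (translate d) (translate c').
  by move=> p; rewrite translateM// c'd translate1.
exists d; split=> // p; rewrite -[LHS]c'dK dcK c'dK //.
Qed.

(** The universal covering is Galois: by [translate_trans] the translations
   are transitive on fibres, and [translate_inv] makes them deck
   transformations. *)
Lemma deck_trans p q : uproj p = uproj q -> exists g : deck e o, g p = q.
Proof.
move=> /translate_trans[c co <-]; have [d [do_ cK dK]] := translate_inv co.
have adj c' : uproj c' = o -> forall p q, uadj p q ->
    uadj (translate c' p) (translate c' q).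
  move=> c'o p' q' /uadjP[pq' ->]; rewrite translate_ustep//.
  by apply: uadj_ustep; rewrite uproj_translate.
unshelve eexists.
  apply: (@Deck _ _ _ (translate c) (translate d) cK dK) => [p' q'|p'].
    by apply/idP/idP; [move/(adj _ do_); rewrite !cK|exact: adj].
  exact: uproj_translate.
by [].
Qed.

Lemma deck_ustep (g : deck e o) p x : e (uproj p) x ->
  g (ustep p x) = ustep (g p) x.
Proof.
move=> px; have := uadj_ustep px; rewrite -(deck_adj g) => /uadjP[_ ->].
by rewrite deck_proj uproj_ustep.
Qed.

Section Lift.
Context (X : Type) (st : V -> V -> X -> X).
Hypothesis stK : forall u v, e u v -> cancel (st u v) (st v u).

(** A family [st] of mutually inverse bijections along the edges is a covering
   graph with fibre [X] above each vertex. The tree covers it as well: [trace j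
   p] is the fibre coordinate reached by lifting the path [p] from the point [j]
   above the base point. *)
Definition trace (j : X) p : X :=
  (foldl (fun uv v => (v, st uv.1 v uv.2)) (o, j) (val p)).2.

Lemma trace_ustep j p x : e (uproj p) x ->
  trace j (ustep p x) = st (uproj p) x (trace j p).
Proof.
have fst_trace s : (foldl (fun uv v => (v, st uv.1 v uv.2)) (o, j) s).1 = last o s.
  by case/lastP: s => // s y; rewrite foldl_rcons last_rcons.
move=> px; rewrite /trace val_ustep// /move; case: ifP; last first.
  by rewrite foldl_rcons /= fst_trace.
case/andP => sn /eqP.
move: px; have := valP p; rewrite -/(reduced _) /uproj.
case/lastP: (val p) sn => // s y _ rs; have [_ sy] := reduced_rcons rs.
rewrite size_rcons /= -cats1 take_size_cat// cats1 last_rcons => yx <-.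
by rewrite foldl_rcons /= fst_trace stK.
Qed.

Lemma trace_deck j (g : deck e o) p :
  trace j (g p) = trace (trace j (g uroot)) p.
Proof.
elim/ucover_ind: p => [|p x px IH] //.
by rewrite deck_ustep// !trace_ustep ?deck_proj// IH.
Qed.

Lemma trace_inj p : injective (trace^~ p).
Proof.
elim/ucover_ind: p => [|p x px IH] // j k; rewrite !trace_ustep// => h.
by apply: IH; apply: (can_inj (stK px)).
Qed.

End Lift.
End Cover.

(** * Finite coverings of large injectivity radius *)

(** This is the residual finiteness of free groups, with its usual proof: the
   steps along edges act as partial injections on the paths of length at most
   [r], partial injections of a finite set extend to permutations, and a short
   path is recovered from its action on the empty path. *)
Section Residual.
Local Open Scope nat_scope.
Context (V : finType) (e : rel V) (o : V).
Hypothesis e_sym : symmetric e.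
Hypothesis e_irr : irreflexive e.
Context (r : nat).
Local Notation T := (ucover e o).
Local Notation M := (r.-bseq V).

Definition short (s : seq V) : M := insubd [bseq] s.

Lemma val_short s : size s <= r -> val (short s) = s.
Proof. by move=> sr; rewrite insubdK. Qed.

Definition movable (u v : V) (b : M) : bool :=
  [&& reduced e o b, last o b == u & size (move o b v) <= r].

(** The partial step from [u] to [v] and its inverse have disjoint domains,
   since [u] and [v] differ; together with the identity elsewhere they form an
   involution. *)
Definition flip (u v : V) (b : M) : M :=
  if movable u v b then short (move o b v)
  else if movable v u b then short (move o b u) else b.

Lemma flipC u v b : u != v -> flip u v b = flip v u b.
Proof.
move=> uv; rewrite /flip; case: ifP => // /and3P[_ /eqP lu _].
by case: ifP => // /and3P[_ /eqP lv _]; rewrite -lu lv eqxx in uv.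
Qed.

Lemma movable_move u v b : e u v -> movable u v b ->
  movable v u (short (move o b v)) /\ short (move o (short (move o b v)) u) = b.
Proof.
move=> uv /and3P[rb /eqP lu sv]; have uv' : e (last o b) v by rewrite lu.
rewrite /movable val_short// move_reduced//= last_move eqxx /= -lu (@moveK _ e _ b)//.
split; first exact: size_bseq.
by apply: val_inj; rewrite val_short//; exact: size_bseq.
Qed.

Lemma flipK u v : e u v -> involutive (flip u v).
Proof.
move=> uv b; have vu : e v u by rewrite e_sym.
have nuv : u != v by apply: contraTneq uv => ->; rewrite e_irr.
rewrite {2}/flip; case: ifP => [m|nm].
  by have [m' mK] := movable_move uv m; rewrite flipC// /flip m'.
case: ifP => [m|nm']; last by rewrite /flip nm nm'.
by have [m' mK] := movable_move vu m; rewrite /flip m'.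
Qed.

Definition flip_perm u v : {perm M} :=
  if boolP (e u v) is AltTrue uv then perm (inv_inj (flipK uv)) else 1%g.

Lemma flip_permE u v b : e u v -> flip_perm u v b = flip u v b.
Proof.
by move=> uv; rewrite /flip_perm; case: {-}_ / boolP => uv';
  [rewrite permE|rewrite uv in uv'].
Qed.

(** The covering whose fibre is the whole group of permutations, rather than
   the set of short paths: a path of the tree is then followed from every
   starting point at the same time, so that the injectivity radius is large at
   each point. *)
Definition voltage (u v : V) (a : {perm M}) : {perm M} := (a * flip_perm u v)%g.

Lemma voltageK u v : e u v -> cancel (voltage u v) (voltage v u).
Proof.
move=> uv a; have vu : e v u by rewrite e_sym.
have nuv : u != v by apply: contraTneq uv => ->; rewrite e_irr.
rewrite /voltage -mulgA -[RHS]mulg1; congr (a * _)%g.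
apply/perm.permP => b; rewrite permM perm1 !flip_permE// [flip v u _]flipC 1?eq_sym//.
exact: flipK.
Qed.

(** Acting on the empty path, the permutations along [p] build [p] step by
   step; the factor [a^-1] removes the starting point. *)
Lemma trace_voltage a (p : T) : size (val p) <= r ->
  trace voltage a p ((a^-1)%g (short [::])) = short (val p).
Proof.
have [s] := ubnP (size (val p)); elim: s p => // s IH p.
case/lastP pE : (val p) => [|q x].
  by move=> _ _; rewrite /trace pE /= permKV.
rewrite size_rcons ltnS => qs qr.
have [q' qE [_ qx qp]] := translate_rcons (uroot e o) pE.
have st0 : size q <= r by exact: ltnW.
rewrite -qp (trace_ustep voltageK)// permM IH ?qE// flip_permE//.
have mq : move o q x = rcons q x by rewrite -pE -qp val_ustep// qE.
have rq : reduced e o q by rewrite -qE; exact: valP.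
rewrite /flip /movable val_short// rq mq size_rcons qr -qE.
by rewrite -/(uproj q') eqxx.
Qed.

Lemma voltage_inj a (p q : T) : size (val p) <= r -> size (val q) <= r ->
  trace voltage a p = trace voltage a q -> p = q.
Proof.
move=> pr qr pq; apply: val_inj.
by rewrite -(val_short pr) -(val_short qr) -!(trace_voltage a)// pq.
Qed.

End Residual.

(** * Local events and measures on configuration spaces *)

Local Open Scope classical_set_scope.
Local Open Scope ring_scope.

Section Prefix.
Context (T : countType) (A : alphabetType).

Definition agree (k : nat) (w w' : T -> A) :=
  forall t, (choice.pickle t < k)%N -> w t = w' t.

Definition determined (k : nat) (C : set (T -> A)) :=
  forall w w', agree k w w' -> C w -> C w'.

Definition prefix_filter (w : T -> A) : set_system (T -> A) :=
  [set P | exists k, agree k w `<=` P].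

Lemma prefix_filter_filter w : Filter (prefix_filter w).
Proof.
split.
- by exists 0%N.
- move=> P Q [k kP] [l lQ]; exists (maxn k l) => w' ww'.
  by split; [apply: kP | apply: lQ] => t tk; apply: ww'; rewrite leq_max tk ?orbT.
- by move=> P Q PQ [k kP]; exists k; apply: subset_trans PQ.
Qed.

(** The sets that contain [agree k w] for some [k] form a filter converging to
   [w] in the product topology, and an open set belongs to the filters of its
   points. *)
Lemma open_prefix (O : set (config T A)) (w : config T A) :
  @open (prod_topology (fun _ : T => discrete_topology A)) O -> O w ->
  exists k, agree k w `<=` O.
Proof.
move=> oO Ow.
have FF := prefix_filter_filter w.
suff : prefix_filter w --> (w : prod_topology (fun _ : T => discrete_topology A)).
  by move=> /(_ O); apply; apply: open_nbhs_nbhs.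
apply/cvg_sup => t P /=.
rewrite /nbhs /= => -[B [[C oC <-] Cw sBP]].
exists (choice.pickle t).+1 => w' ww'; apply: sBP => /=.
by rewrite -ww'.
Qed.

Lemma measurable_coord (t : T) (a : A) :
  measurable ([set w | w t = a] : set (config T A)).
Proof.
apply: sub_sigma_algebra.
apply: (@open_comp (prod_topology (fun _ : T => discrete_topology A))
  (discrete_topology A) (fun w => w t) [set a]); last exact: discrete_open.
by move=> w _; apply: (@proj_continuous T (fun _ => discrete_topology A) t).
Qed.

End Prefix.

Lemma pushforward_probability (R : realType) d d' (S : measurableType d)
    (S' : measurableType d') (P : probability S R) (f : S -> S') :
  measurable_fun setT f ->
  exists Q : probability S' R, forall X, Q X = P (f @^-1` X).
Proof.
move=> mf.
pose F : {mfun S >-> S'} := HB.pack_for {mfun S >-> S'} f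
  (isMeasurableFun.Build _ _ _ _ f mf).
by exists (distribution P F).
Qed.

Section Uniform.
Context (R : realType).

Definition unit_itv : set (measurableTypeR R) := [set u | 0 <= u < 1].

Lemma unit_itvE : unit_itv = `[0, 1[%classic.
Proof. by rewrite predeqE => u; rewrite /= in_itv. Qed.

Lemma measurable_unit_itv : measurable unit_itv.
Proof. by rewrite unit_itvE; exact: measurable_itv. Qed.

Lemma lebesgue_unit_itv : lebesgue_measure unit_itv = 1%:E :> \bar R.
Proof.
by rewrite unit_itvE lebesgue_measure_itv /= lte_fin ltr01 sube0.
Qed.

Definition unif := mrestr (@lebesgue_measure R) measurable_unit_itv.

HB.instance Definition _ := Measure.on unif.

Lemma unifT : unif setT = 1%E.
Proof. by rewrite /unif /mrestr setTI lebesgue_unit_itv. Qed.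

HB.instance Definition _ := Measure_isProbability.Build _ _ _ unif unifT.

End Uniform.

Section Slots.
Context (R : realType) (A : eqType) (c : A -> R) (c_ge0 : forall a, 0 <= c a).

(** The interval from 0 to the sum of the lengths [c b] is cut into
   consecutive slots; [offset s a] is the left end of the slot of [a]. *)
Fixpoint offset (s : seq A) (a : A) : R :=
  if s is b :: s' then if a == b then 0 else c b + offset s' a else 0.

Lemma offset_ge0 s a : 0 <= offset s a.
Proof. by elim: s => //= b s IH; case: ifP => // _; rewrite addr_ge0. Qed.

Lemma offset_le s a : a \in s -> offset s a + c a <= \sum_(b <- s) c b.
Proof.
elim: s => //= b s IH; rewrite inE big_cons; case: eqVneq => [->|_] /=.
  by rewrite add0r lerDl sumr_ge0.
by move=> /IH; rewrite -addrA lerD2l.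
Qed.

Lemma slot_exists s (u : R) : uniq s -> 0 <= u < \sum_(b <- s) c b ->
  exists2 a, a \in s & offset s a <= u < offset s a + c a.
Proof.
elim: s u => [|b s IH] u; first by rewrite big_nil; lra.
rewrite big_cons /= => /andP[bs us] u_in; case: (ltP u (c b)) => ub.
  by exists b; rewrite ?mem_head//= eqxx; lra.
have [//||a as_ aP] := IH (u - c b); first by lra.
have ab : a != b by apply: contraNneq bs => <-.
by exists a; rewrite ?inE ?as_ ?orbT//= (negPf ab); lra.
Qed.

Lemma slot_unique s (u : R) a a' : a \in s -> a' \in s ->
  offset s a <= u < offset s a + c a ->
  offset s a' <= u < offset s a' + c a' -> a = a'.
Proof.
elim: s u => //= b s IH u; rewrite !inE.
case: (eqVneq a b) => [->|ab]; case: (eqVneq a' b) => [->|a'b] //=.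
- by move=> _ _ h h'; have h0 := offset_ge0 s a'; exfalso; lra.
- by move=> _ _ h h'; have h0 := offset_ge0 s a; exfalso; lra.
- by move=> sa sa' h h'; apply: (IH (u - c b) sa sa'); lra.
Qed.

End Slots.

(** A finitely additive content on configurations agrees on local events with
   a probability measure. The measure is realized as an image of the uniform law:
   at each depth the unit interval is cut into consecutive slots, indexed by the
   words of that length and as long as the content of their cylinders, each slot
   being subdivided at the next depth; a point is sent to the configuration
   spelled by the slots that contain it. This takes care of countable additivity
   without any compactness. *)
Section Extension.
Context (R : realType) (T : countType) (A : alphabetType).
Context (l : set (T -> A) -> R).
Hypothesis l_ge0 : forall C, 0 <= l C.
Hypothesis lT : l setT = 1.
Hypothesis lU : forall C C', C `&` C' = set0 -> l (C `|` C') = l C + l C'.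

(** Coordinates are numbered by the codes of the sites. Numbers that code no
   site get a fixed letter, so that words of any length describe cylinders. *)
Definition coord (w : T -> A) (n : nat) : A :=
  if (choice.pickle_inv n : option T) is Some t then w t else point.

Lemma coord_pickle w t : coord w (choice.pickle t) = w t.
Proof. by rewrite /coord choice.pickleK_inv. Qed.

(** Words are stored with the last letter first: extending a word is a
   [cons]. *)
Fixpoint cyl (r : seq A) : set (T -> A) :=
  if r is a :: r' then cyl r' `&` [set w | coord w (size r') = a] else setT.

Definition mass r := l (cyl r).

Lemma content_set0 : l set0 = 0.
Proof.
have := lU (setIid (set0 : set (T -> A))).
by rewrite setUid => /eqP; rewrite -subr_eq subrr eq_sym => /eqP.
Qed.

Lemma content_bigU (I : choiceType) (s : seq I) (F : I -> set (T -> A)) : uniq s ->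
  (forall i j, i != j -> F i `&` F j = set0) ->
  l (\big[setU/set0]_(i <- s) F i) = \sum_(i <- s) l (F i).
Proof.
move=> us dis; elim: s us => [|i s IH] /=; first by rewrite !big_nil content_set0.
move=> /andP[nis us]; rewrite !big_cons lU ?IH//.
rewrite -subset0 => w [Fi]; rewrite -bigcup_seq => -[j /= js Fj].
have : (F i `&` F j) w by [].
by rewrite dis//; apply: contraNneq nis => ->.
Qed.

Lemma mass_rcons r : \sum_(a <- enum A) mass (a :: r) = mass r.
Proof.
rewrite -content_bigU ?enum_uniq//; last first.
  move=> a b ab; rewrite -subset0 => w [[_ wa] [_ wb]].
  by move: ab; rewrite -wa -wb eqxx.
congr l; rewrite predeqE => w; split => [|cw].
  by rewrite -bigcup_seq => -[a _ []].
by rewrite -bigcup_seq; exists (coord w (size r)) => //=; rewrite mem_enum.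
Qed.

Fixpoint slot_start (r : seq A) : R :=
  if r is a :: r' then slot_start r' + offset (fun b => mass (b :: r')) (enum A) a
  else 0.

Definition slot (r : seq A) (u : R) := slot_start r <= u < slot_start r + mass r.

Lemma slot_nil u : slot [::] u = (0 <= u < 1).
Proof. by rewrite /slot /= /mass /= lT add0r. Qed.

Lemma slot_cons_sub a r u : slot (a :: r) u -> slot r u.
Proof.
rewrite /slot /= => h.
have := @offset_ge0 _ _ (fun b => mass (b :: r)) (fun b => l_ge0 _) (enum A) a.
have := @offset_le _ _ (fun b => mass (b :: r)) (fun b => l_ge0 _) (enum A) a.
by rewrite mem_enum mass_rcons => /(_ isT); lra.
Qed.

Lemma slot_cons_ex r u : slot r u -> exists a, slot (a :: r) u.
Proof.
rewrite /slot => h.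
have [|a _ ?] := @slot_exists _ _ (fun b => mass (b :: r))
  (enum A) (u - slot_start r) (enum_uniq _).
  by rewrite mass_rcons; lra.
by exists a => /=; lra.
Qed.

Lemma slot_cons_uniq r u a a' : slot (a :: r) u -> slot (a' :: r) u -> a = a'.
Proof.
rewrite /slot => h h'.
apply: (@slot_unique _ _ (fun b => mass (b :: r)) (fun b => l_ge0 _)
  (enum A) (u - slot_start r)); rewrite ?mem_enum//; move: h h' => /=; lra.
Qed.

Fixpoint slot_word (u : R) (k : nat) : seq A :=
  if k is k'.+1 then
    let r := slot_word u k' in odflt point [pick a | slot (a :: r) u] :: r
  else [::].

Lemma slot_wordP u k : 0 <= u < 1 -> slot (slot_word u k) u.
Proof.
move=> u01; elim: k => [|k IH]; first by rewrite slot_nil.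
rewrite /slot_word -/slot_word; case: pickP => //= no.
by have [a sa] := slot_cons_ex IH; rewrite no in sa.
Qed.

Lemma slot_slot_word u r : slot r u -> slot_word u (size r) = r.
Proof.
elim: r => //= a r IH sa; rewrite IH ?(slot_cons_sub sa)//; congr (_ :: _).
case: pickP => [b sb|no] /=; first exact: slot_cons_uniq sb sa.
by rewrite no in sa.
Qed.

Definition digit u n : A := head point (slot_word u n.+1).

(** Outside of the unit interval, which is negligible, the value at 0 is
   used. *)
Definition realize (u : measurableTypeR R) : config T A :=
  fun t => digit (if 0 <= u < 1 then u else 0) (choice.pickle t).

(** When the next number codes no site, the only extension of nonempty slot is
   by the fixed letter, in agreement with [coord]. *)
Lemma realize_cyl u r : 0 <= u < 1 -> cyl r (realize u) <-> slot r u.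
Proof.
move=> u01; elim: r => [|a r IH]; first by rewrite slot_nil u01.
suff key : slot r u -> (coord (realize u) (size r) = a <-> slot (a :: r) u).
  split; first by move=> /= [/IH sr] /(key sr).
  by move=> sa; have sr := slot_cons_sub sa; split; [apply/IH|apply/(key sr)].
move=> sr; rewrite /coord.
case E : (choice.pickle_inv _) => [t|].
  have := @choice.pickle_invK T (size r); rewrite /oapp E => tr.
  rewrite /realize u01 tr /digit/= slot_slot_word//.
  split => [<-|sa]; first by have := slot_wordP (size r).+1 u01; rewrite /= slot_slot_word.
  case: pickP => [b sb|no] /=; first exact: slot_cons_uniq sb sa.
  by rewrite no in sa.
have only b : slot (b :: r) u -> b = point.
  move=> sb; apply: contrapT => bp; move: sb; rewrite /slot.
  have -> : mass (b :: r) = 0; last by lra.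
  rewrite /mass; have -> : cyl (b :: r) = set0; last exact: content_set0.
  by rewrite -subset0 => w [_] /=; rewrite /coord E => /esym.
have [b sb] := slot_cons_ex sr; split => [<-|/only//].
by rewrite -(only _ sb).
Qed.

Local Notation I01 := (@unit_itv R).

Let slot_itv r : [set u : measurableTypeR R | slot r u] = `[slot_start r,
  (slot_start r + mass r)[%classic.
Proof. by rewrite predeqE => u; rewrite /= in_itv. Qed.

Lemma realize_preimage r :
  realize @^-1` (cyl r) `&` I01 = [set u : measurableTypeR R | slot r u].
Proof.
rewrite predeqE => u; split => [[cu u01]|su]; first exact/(realize_cyl r u01).
suff u01 : I01 u by split => //; apply/(realize_cyl r u01).
elim: r su => [|a r IH]; first by rewrite /= slot_nil.
by move=> /slot_cons_sub.
Qed.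

Lemma measurable_preimage_cyl r : measurable (realize @^-1` (cyl r)).
Proof.
rewrite -(setIT (_ @^-1` _)) -(setUv I01) setIUr; apply: measurableU.
  by rewrite realize_preimage slot_itv; exact: measurable_itv.
have out u : ~ I01 u -> realize u = realize 0.
  move=> /negP u01; apply/funext => t; rewrite /realize (negPf u01).
  by rewrite lexx ltr01.
have [c0|c0] := pselect (cyl r (realize 0)).
  have -> : realize @^-1` cyl r `&` ~` I01 = ~` I01.
    by apply/setIidPr => u /= /out; rewrite /preimage /= => ->.
  exact: (measurableC (@measurable_unit_itv R)).
suff -> : realize @^-1` cyl r `&` ~` I01 = set0 by exact: measurable0.
by rewrite -subset0 => u /= [] + /out; rewrite /preimage /= => + uE; rewrite uE.
Qed.

Lemma cyl_agree r w w' : cyl r w -> cyl r w' -> agree (size r) w w'.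
Proof.
elim: r => //= a r IH [/IH h wa] [/h{}h w'a] t.
rewrite ltnS leq_eqVlt => /predU1P[tr|]; last exact: h.
by rewrite -2!coord_pickle tr wa w'a.
Qed.

Lemma cyl_inj x y w : size x = size y -> cyl x w -> cyl y w -> x = y.
Proof.
elim: x y => [|a x IH] [|b y] // [xy] [cx xa] [cy yb].
by rewrite -xa -yb xy (IH _ xy cx cy).
Qed.

Lemma cyl_ex (w : T -> A) k : exists r : k.-tuple A, cyl r w.
Proof.
elim: k => [|k [r rw]]; first by exists [tuple].
by exists [tuple of coord w k :: r]; rewrite /= size_tuple.
Qed.

Lemma measurable_realize : measurable_fun setT realize.
Proof.
apply: (@measurability _ _ _ _ setT realize
  (@open (prod_topology (fun _ : T => discrete_topology A)))) => //.
move=> _ [] O oO <-; rewrite setTI.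
have -> : realize @^-1` O = \bigcup_(r : seq A)
    (if pselect (cyl r `<=` O) then realize @^-1` cyl r else set0).
  rewrite predeqE => u; split => [Ou|[r _]]; last first.
    by case: pselect => // rO /rO.
  have [k kO] := open_prefix oO Ou.
  have [r rw] := cyl_ex (realize u) k.
  exists r => //; case: pselect => // -[] w rw'; apply: kO.
  by have := cyl_agree rw rw'; rewrite size_tuple.
apply: countable_bigcupT_measurable; first exact: countableP.
by move=> r; case: pselect => ? /=; [exact: measurable_preimage_cyl|exact: measurable0].
Qed.

Lemma measurable_cyl r : measurable (cyl r : set (config T A)).
Proof.
elim: r => [|a r IH] /=; first exact: measurableT.
apply: measurableI => //; rewrite /coord.
case: (choice.pickle_inv _) => [t|]; first exact: measurable_coord.
have [ap|ap] := eqVneq point a.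
  by rewrite (_ : [set _ | _] = setT) ?predeqE//; exact: measurableT.
rewrite (_ : [set _ | _] = set0); first exact: measurable0.
by rewrite -subset0 => w /= pa; rewrite pa eqxx in ap.
Qed.

Lemma determined_cover k (C : set (T -> A)) : determined k C ->
  exists2 s : seq (k.-tuple A), uniq s & C = \big[setU/set0]_(r <- s) cyl r.
Proof.
move=> detC.
exists [seq r : k.-tuple A <- enum {: k.-tuple A} | `[< cyl r `<=` C >]].
  by rewrite filter_uniq// enum_uniq.
rewrite predeqE => w; rewrite -bigcup_seq; split => [Cw|[r]].
  have [r rw] := cyl_ex w k; exists r => //=.
  rewrite mem_filter mem_enum andbT; apply/asboolP => w' rw'.
  by apply: (detC w) => //; have := cyl_agree rw rw'; rewrite size_tuple.
by rewrite /= mem_filter => /andP[/asboolP rC _] /rC.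
Qed.

Lemma determined_measurable k (C : set (config T A)) :
  determined k C -> measurable C.
Proof.
move=> /determined_cover[s _ ->].
by apply: bigsetU_measurable => r _; exact: measurable_cyl.
Qed.

(** Local events are finite disjoint unions of cylinders, and the preimage of
   a cylinder is a slot of the right length. *)
Lemma finadd_extension : exists nu : probability (config T A) R,
  forall (k : nat) (C : set (config T A)),
    determined k C -> nu C = (l C)%:E.
Proof.
have [nu nuE] := pushforward_probability (@unif R) measurable_realize.
exists nu => k C detC.
have dis (r r' : k.-tuple A) : r != r' -> cyl r `&` cyl r' = set0.
  move=> rr'; rewrite -subset0 => w [rw r'w]; case/negP: rr'; apply/eqP/val_inj.
  by apply: cyl_inj rw r'w; rewrite !size_tuple.
have [s us ->] := determined_cover detC.
rewrite (content_bigU us dis) -sumEFin.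
elim: s us => [|r s' IH] us; first by rewrite !big_nil measure0.
move: us => /= /andP[nrs us]; rewrite !big_cons measureU.
- congr (_ + _)%E; last exact: IH.
  apply: etrans (nuE (cyl r)) _;
  transitivity (lebesgue_measure (realize @^-1` (cyl r) `&` I01)); first by [].
  rewrite realize_preimage slot_itv lebesgue_measure_itv /= lte_fin ltrDl.
  have [mr|] := ltP 0 (mass r); first by rewrite -EFinD addrAC subrr add0r.
  by rewrite /mass => m0; congr EFin; apply/eqP; rewrite eq_le l_ge0.
- exact: measurable_cyl.
- by apply: bigsetU_measurable => i _; exact: measurable_cyl.
- rewrite -subset0 => w [rw]; rewrite -bigcup_seq => -[r' /= js r'w].
  have : (cyl r `&` cyl r') w by [].
  by rewrite dis//; apply: contraNneq nrs => ->.
Qed.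

End Extension.

Lemma fmap_ultra (S S' : Type) (f : S -> S') (U : set_system S) :
  UltraFilter U -> UltraFilter (f @ U).
Proof.
move=> uU; split=> [|G pG UG]; first exact: fmap_proper_filter.
rewrite predeqE => B; split=> [GB|]; last exact: UG.
have [//|UB] := in_ultra_setVsetC (f @^-1` B) uU.
by have /filter_ex[x []] : G (B `&` ~` B) by apply: filterI => //; apply: UG.
Qed.

Section Ultralimit.
Import numFieldNormedType.Exports.
Context (R : realType).

Definition bounded_seq (u : nat -> R) := exists M, forall n, `|u n| <= M.

(** Limits along an ultrafilter that refines convergence at infinity. *)
Lemma ultralimit_ex : exists L : (nat -> R) -> R,
  [/\ forall u v, bounded_seq u -> bounded_seq v -> L (fun n => u n + v n) = L u + L v,
      forall u v, bounded_seq u -> bounded_seq v -> L (fun n => u n * v n) = L u * L v &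
      forall u c, bounded_seq u -> (\forall n \near \oo, u n <= c) -> L u <= c].
Proof.
have [U [uU ooU]] := @ultraFilterLemma nat \oo _.
have cU u : bounded_seq u -> cvg (u @ U).
  move=> [M uM].
  have /= := @segment_compact R (- M) M.
  rewrite compact_ultra => /(_ (u @ U)) [||].
  - exact: fmap_ultra.
  - suff : U (u @^-1` `[- M, M]) by [].
    by apply: filterE => n /=; rewrite in_itv /= -ler_norml uM.
  - by move=> l [_ ul]; apply/cvg_ex; exists l.
exists (fun u => lim (u @ U)); split.
- move=> u v bu bv; apply/cvg_lim => //; apply: cvgD; exact: cU.
- by move=> u v bu bv; apply/cvg_lim => //; apply: cvgM; exact: cU.
- by move=> u c bu uc; apply: limr_le; [exact: cU|exact: ooU].
Qed.

End Ultralimit.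

Section Approximation.
Import numFieldNormedType.Exports.
Context (R : realType) (T : countType) (A : alphabetType).
Context (J : finType) (P : J -> probability (config T A) R).

Definition symdiff (X Y : set (config T A)) := (X `\` Y) `|` (Y `\` X).

(** The approximation is simultaneous for finitely many measures, and
   measurability is included so that the property can be shown to be stable under
   set operations. *)
Definition approximable (X : set (config T A)) :=
  measurable X /\ forall eps : R, 0 < eps -> exists k C,
    determined k C /\ forall i, (P i (symdiff X C) < eps%:E)%E.

Lemma measurable_symdiff X Y :
  measurable X -> measurable Y -> measurable (symdiff X Y).
Proof. by move=> mX mY; apply: measurableU; apply: measurableD. Qed.

Lemma determined_le k k' (C : set (T -> A)) : (k <= k')%N ->
  determined k C -> determined k' C.
Proof.
by move=> kk' dC w w' ww'; apply: dC => t tk; apply: ww'; apply: leq_trans kk'.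
Qed.

Lemma determined_approximable k (C : set (config T A)) :
  determined k C -> approximable C.
Proof.
move=> dC; split => [|eps eps0]; first exact: determined_measurable dC.
exists k, C; split=> // i.
by rewrite /symdiff setDv setU0 measure0 lte_fin.
Qed.

Lemma approximable_bigU (F : nat -> set (config T A)) n :
  (forall m, approximable (F m)) -> approximable (\big[setU/set0]_(m < n) F m).
Proof.
move=> aF; elim: n => [|n [mF IH]].
  by rewrite big_ord0; apply: (@determined_approximable 0%N).
rewrite big_ord_recr /=; have [mFn aFn] := aF n; split; first exact: measurableU.
move=> eps eps0; have e2 : 0 < eps / 2 by lra.
have [k [C [dC PC]]] := IH _ e2; have [k' [C' [dC' PC']]] := aFn _ e2.
have dC2 := determined_le (leq_maxl k k') dC.
have dC2' := determined_le (leq_maxr k k') dC'.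
exists (maxn k k'), (C `|` C'); split.
  by move=> w w' ww' [Cw|Cw]; [left; apply: dC2 Cw|right; apply: dC2' Cw].
move=> i.
have mC := determined_measurable dC; have mC' := determined_measurable dC'.
set F1 := \big[setU/set0]_(m < n) F m in mF PC *.
have m1 := measurable_symdiff mF mC; have m2 := measurable_symdiff mFn mC'.
apply: (@le_lt_trans _ _ (P i (symdiff F1 C `|` symdiff (F n) C'))).
  apply: le_measure; rewrite ?inE; [|exact: measurableU|].
    by apply: measurable_symdiff; apply: measurableU.
  move=> w [[[Fw|Fw] nC]|[[Cw|Cw] nF]].
  - by left; left; split=> // Cw; apply: nC; left.
  - by right; left; split=> // Cw; apply: nC; right.
  - by left; right; split=> // Fw; apply: nF; left.
  - by right; right; split=> // Fw; apply: nF; right.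
apply: le_lt_trans (measureU2 _ m1 m2) _.
have -> : (eps%:E = (eps / 2)%:E + (eps / 2)%:E)%E by rewrite -EFinD -splitr.
by apply: lteD; [exact: PC|exact: PC'].
Qed.

(** Finite unions approximate the countable one, by continuity from above of
   each of the finitely many measures. *)
Lemma approximable_bigcup (F : nat -> set (config T A)) :
  (forall m, approximable (F m)) -> approximable (\bigcup_m F m).
Proof.
move=> aF; have mU : measurable (\bigcup_m F m).
  by apply: bigcupT_measurable => m; case: (aF m).
split=> // eps eps0; have e2 : 0 < eps / 2 by lra.
pose F1 n := \big[setU/set0]_(m < n) F m.
pose D n := \bigcup_m F m `\` F1 n.
have mF1 n : measurable (F1 n) by case: (approximable_bigU n aF).
have mD n : measurable (D n) by apply: measurableD.
have D0 : \bigcap_n D n = set0.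
  rewrite -subset0 => w Dw; have [[m _ Fm] _] := Dw 0%N I.
  by have [_] := Dw m.+1 I; apply; rewrite /F1 big_ord_recr; right.
have near_i i : \forall n \near \oo, (P i (D n) < (eps / 2)%:E)%E.
  have : P i (D n) @[n --> \oo] --> (0 : \bar R)%E.
    rewrite -(measure0 (P i)) -D0; apply: nonincreasing_cvg_mu => //.
    - by rewrite ltey_eq fin_num_measure.
    - by rewrite D0.
    - move=> m n mn; apply/subsetPset => w [Uw nF]; split=> // Fw; apply: nF.
      move: Fw; rewrite /F1 -!bigcup_mkord => -[j /= jm Fj].
      by exists j => //=; apply: leq_trans mn.
  move=> /fine_cvgP[_] /cvgrPdist_lt/(_ _ e2); apply: filterS => n.
  rewrite sub0r normrN ger0_norm ?fine_ge0//= => h.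
  by rewrite -[X in (X < _)%E]fineK ?fin_num_measure// lte_fin.
have [n Dn] : exists n, forall i, (P i (D n) < (eps / 2)%:E)%E.
  have : \forall n \near \oo, forall i, (P i (D n) < (eps / 2)%:E)%E.
    exact: filter_forall.
  by move=> /filter_ex.
have [_ /(_ _ e2)[k [C [dC PC]]]] := approximable_bigU n aF.
exists k, C; split=> // i; have mC := determined_measurable dC.
have m1 := measurable_symdiff (mF1 n) mC.
apply: (@le_lt_trans _ _ (P i (D n `|` symdiff (F1 n) C))).
  apply: le_measure; rewrite ?inE; [exact: measurable_symdiff|exact: measurableU|].
  move=> w [[Uw nC]|[Cw nU]].
    by have [Fw|nF] := pselect (F1 n w); [right; left|left].
  right; right; split=> //; rewrite /F1 -bigcup_mkord => -[m _ Fm].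
  by apply: nU; exists m.
apply: le_lt_trans (measureU2 _ (mD n) m1) _.
have -> : (eps%:E = (eps / 2)%:E + (eps / 2)%:E)%E by rewrite -EFinD -splitr.
by apply: lteD; [exact: Dn|exact: PC].
Qed.

Lemma approximable_open (O : set (config T A)) :
  @open (prod_topology (fun _ : T => discrete_topology A)) O -> approximable O.
Proof.
move=> oO.
have -> : O = \bigcup_k [set w | agree k w `<=` O].
  rewrite predeqE => w; split => [Ow|[k _]]; last by apply.
  by have [k kO] := open_prefix oO Ow; exists k.
apply: approximable_bigcup => k; apply: (@determined_approximable k).
move=> w w' ww' /= wO v w'v; apply: wO => t tk.
by rewrite ww'// w'v.
Qed.

(** The approximable events form a sigma-algebra, and it contains the open
   sets, which are countable unions of local events. *)
Lemma measurable_approximable (X : set (config T A)) :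
  measurable X -> approximable X.
Proof.
apply: smallest_sub; last exact: approximable_open.
split.
- exact: (@determined_approximable 0%N).
- move=> Y [mY aY]; rewrite setTD; split; first exact: measurableC.
  move=> eps /aY[k [C [dC PC]]]; exists k, (~` C); split.
    move=> w w' ww' nC Cw'; apply: nC; apply: dC Cw' => t tk.
    by rewrite ww'.
  move=> i; suff -> : symdiff (~` Y) (~` C) = symdiff Y C by exact: PC.
  by rewrite /symdiff !setDE !setCK setUC [C `&` _]setIC [Y `&` _]setIC.
- exact: approximable_bigcup.
Qed.

End Approximation.

(** * Finite-volume Gibbs weights *)

Section Balls.
Context (W : choiceType) (adj : rel W).
Hypothesis adj_sym : symmetric adj.

Lemma Ball_refl D v : Ball adj D v v.
Proof. by exists [::]. Qed.

Lemma Ball_sym D u v : Ball adj D u v -> Ball adj D v u.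
Proof.
move=> [p [pp pl ps]]; exists (rev (belast u p)); split.
- rewrite -pl rev_path; move: pp.
  by congr (is_true (path _ _ _)); apply/funext => x; apply/funext => y; rewrite adj_sym.
- by case: p pl {pp ps} => [|x p] //= _; rewrite rev_cons last_rcons.
- by rewrite size_rev size_belast.
Qed.

Lemma Ball_trans D D' u v w : Ball adj D u v -> Ball adj D' v w ->
  Ball adj (D + D') u w.
Proof.
move=> [p [pp pl ps]] [q [qp ql qs]]; exists (p ++ q); split.
- by rewrite cat_path pp pl qp.
- by rewrite last_cat pl.
- by rewrite size_cat leq_add.
Qed.

Lemma Ball_le D D' u v : (D <= D')%N -> Ball adj D u v -> Ball adj D' u v.
Proof. by move=> DD [p [pp pl ps]]; exists p; split=> //; apply: leq_trans DD. Qed.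

Definition nbh D (X : set W) : set W := X `|` bdry adj D X.

Lemma nbhP D X v : nbh D X v <-> exists2 u, X u & Ball adj D u v.
Proof.
split=> [[Xv|[_ //]]|[u Xu uv]]; first by exists v => //; exact: Ball_refl.
by have [Xv|nXv] := pselect (X v); [left|right; split=> //; exists u].
Qed.

End Balls.

Section Local.
Context (R : realType) (W : choiceType) (adj : rel W) (A : alphabetType).
Hypothesis adj_sym : symmetric adj.
Hypothesis Ball_fin : forall D v, finite_set (Ball adj D v).
Context (D : nat) (psi : potential R adj A D).
Implicit Types (L : {fset W}) (w : W -> A).

Definition overwrite L (s : {ffun L -> A}) w : W -> A :=
  fun v => if insub v is Some u then s u else w v.

Definition restriction L w : {ffun L -> A} := [ffun u : L => w (val u)].

Lemma overwrite_in L (s : {ffun L -> A}) w (u : L) : overwrite s w (val u) = s u.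
Proof. by rewrite /overwrite valK. Qed.

Lemma overwrite_out L (s : {ffun L -> A}) w v : v \notin L -> overwrite s w v = w v.
Proof. by move=> vL; rewrite /overwrite insubN. Qed.

Lemma overwrite_overwrite L (s s' : {ffun L -> A}) w : overwrite s (overwrite s' w) =
  overwrite s w.
Proof. by apply/funext => v; rewrite /overwrite; case: insubP. Qed.

Lemma overwrite_restriction L w : overwrite (restriction L w) w = w.
Proof. by apply/funext => v; rewrite /overwrite; case: insubP => //= u _ <-;
  rewrite ffunE. Qed.

Lemma restriction_overwrite L (s : {ffun L -> A}) w : restriction L (overwrite s w) = s.
Proof. by apply/ffunP => u; rewrite ffunE overwrite_in. Qed.

Lemma nbh_fin k L : finite_set (nbh adj k [set` L]).
Proof.
apply: (@sub_finite_set _ _ (\bigcup_(u in [set` L]) Ball adj k u)).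
  by move=> v /nbhP[u Lu uv]; exists u.
by apply: bigcup_finite => //; exact: finite_fset.
Qed.

Definition energy L w : R := \sum_(v \in nbh adj D [set` L]) pot_at psi v w.

Lemma pot_at_eq v w w' : (forall u, Ball adj D v u -> w u = w' u) ->
  pot_at psi v w = pot_at psi v w'.
Proof.
move=> ww'; rewrite /pot_at; congr (psi _); apply/funext => -[u /= Hu].
by apply: ww'; apply: set_mem Hu.
Qed.

Lemma nbh2 L v u : nbh adj D [set` L] v -> Ball adj D v u ->
  nbh adj (2 * D) [set` L] u.
Proof.
move=> /nbhP[x Lx xv] vu; apply/nbhP; exists x => //.
by rewrite mul2n -addnn; apply: Ball_trans vu.
Qed.

Lemma energy_eq L w w' :
  (forall u, nbh adj (2 * D) [set` L] u -> w u = w' u) ->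
  energy L w = energy L w'.
Proof.
move=> ww'; apply: eq_fsbigr => v /set_mem vL.
by apply: pot_at_eq => u vu; apply: ww'; apply: nbh2 vu.
Qed.

(** A vertex whose potential enters the weight sees only [L] and its boundary,
   hence the padding of [glue_config] can be replaced by any configuration with
   the right boundary. *)
Lemma weightE L (s : {ffun L -> A}) w :
  weight psi s (pr (X := bdry adj (2 * D) [set` L]) w) = expR (- energy L (overwrite s w)).
Proof.
rewrite /weight; congr (expR (- _)); apply: eq_fsbigr => v /set_mem vL.
apply: pot_at_eq => u vu; rewrite /glue_config /overwrite.
case: insubP => //= uL; have [/= uL'|bu] := nbh2 vL vu; first by rewrite uL' in uL.
case: insubP => [u' _ u'u|]; last by rewrite mem_set.
by rewrite /pr -u'u.
Qed.

(** The Gibbs law in the finite volume [L] with boundary condition [w], as a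
   function of total configurations; the values of [w] in [L] are
   overwritten. *)
Definition gibbs_spec L w (s : {ffun L -> A}) : R :=
  expR (- energy L (overwrite s w)) /
  \sum_(s' : {ffun L -> A}) expR (- energy L (overwrite s' w)).

Lemma sum_exp_gt0 L w :
  0 < \sum_(s' : {ffun L -> A}) expR (- energy L (overwrite s' w)).
Proof.
rewrite (bigD1 (restriction L w)) //= ltr_wpDr ?expR_gt0//.
by apply: sumr_ge0 => s _; exact: expR_ge0.
Qed.

Lemma gibbs_spec_ge0 L w s : 0 <= gibbs_spec (L := L) w s.
Proof. by apply: divr_ge0; [exact: expR_ge0|exact/ltW/sum_exp_gt0]. Qed.

Lemma gibbs_spec_sum L w : \sum_s gibbs_spec (L := L) w s = 1.
Proof. by rewrite -mulr_suml divff// gt_eqF// sum_exp_gt0. Qed.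

Lemma gibbs_spec_eq L w w' s : (forall u, nbh adj (2 * D) [set` L] u -> w u = w' u) ->
  gibbs_spec (L := L) w s = gibbs_spec w' s.
Proof.
move=> ww'.
have ow s' : energy L (overwrite s' w) = energy L (overwrite s' w').
  by apply: energy_eq => u Lu; rewrite /overwrite; case: insubP => // _; exact: ww'.
by rewrite /gibbs_spec ow; congr (_ / _); apply: eq_bigr => s' _; rewrite ow.
Qed.

Lemma gibbs_spec_overwrite L w (s s' : {ffun L -> A}) : gibbs_spec (L :=
  L) (overwrite s' w) s = gibbs_spec w s.
Proof.
by rewrite /gibbs_spec overwrite_overwrite; congr (_ / _); apply: eq_bigr => s1 _;
  rewrite overwrite_overwrite.
Qed.

Lemma gibbs_spec_weight L w s : let t := pr (X := bdry adj (2 * D) [set` L]) w in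
  weight psi s t / \sum_s' weight psi s' t = gibbs_spec (L := L) w s.
Proof.
by rewrite /= weightE; congr (_ / _); apply: eq_bigr => s' _; rewrite weightE.
Qed.

(** Resampling [L] by its conditional law preserves the Gibbs weights. The
   exchange of a new content [s] of [L] with the old one is an involution on the
   pairs (state, [s]), and it preserves [lift_weight x * gibbs_spec (Psi x) s]
   (detailed balance). The system is an abstract finite set [Omega] of states,
   seen near [L] through [Psi], because the lemma is applied both to
   configurations in a larger finite volume and to configurations on finite
   coverings. *)
Lemma heat_bath L (Omega : finType) (Psi : Omega -> W -> A)
    (ov : {ffun L -> A} -> Omega -> Omega) (rest : Omega -> R) (lift_weight : Omega -> R) :
  (forall s x u, nbh adj (2 * D) [set` L] u -> Psi (ov s x) u = overwrite s (Psi x) u) ->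
  (forall s s' x, ov s (ov s' x) = ov s x) ->
  (forall x, ov (restriction L (Psi x)) x = x) ->
  (forall s x, rest (ov s x) = rest x) ->
  (forall x, lift_weight x = expR (- (energy L (Psi x) + rest x))) ->
  forall h : Omega -> R,
  \sum_x lift_weight x * h x = \sum_x lift_weight x * \sum_s gibbs_spec (Psi x) s * h (ov
    s x).
Proof.
move=> PsiE ovov ovK restE lift_weightE h.
have LL u : u \in L -> nbh adj (2 * D) [set` L] u by move=> Lu; left.
have res_ov s x : restriction L (Psi (ov s x)) = s.
  by apply/ffunP => u; rewrite ffunE PsiE ?overwrite_in//; apply: LL; exact: valP.
have gibbs_spec_ov s s' x : gibbs_spec (L := L) (Psi (ov s' x)) s = gibbs_spec (Psi x) s.
  by rewrite (@gibbs_spec_eq _ _ (overwrite s' (Psi x))) ?gibbs_spec_overwrite//;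
    exact: PsiE.
have lift_weight_ov s x : lift_weight (ov s x) =
  expR (- energy L (overwrite s (Psi x))) * expR (- rest x).
  by rewrite lift_weightE opprD expRD restE; congr (expR (- _) * _); apply: energy_eq;
    exact: PsiE.
have lift_weight_id x : lift_weight x = expR (- energy L (Psi x)) * expR (- rest x).
  by rewrite lift_weightE opprD expRD.
have balance s x : lift_weight x * gibbs_spec (Psi x) s =
    lift_weight (ov s x) * gibbs_spec (Psi x) (restriction L (Psi x)).
  rewrite lift_weight_ov lift_weight_id /gibbs_spec overwrite_restriction; ring.
pose f (xs : Omega * {ffun L -> A}) := (ov xs.2 xs.1, restriction L (Psi xs.1)).
have fK : involutive f.
  by case=> x s; rewrite /f /= res_ov ovov ovK.
under [RHS]eq_bigr => x _ do rewrite mulr_sumr.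
rewrite pair_bigA /= (reindex_inj (inv_inj fK)) /=.
transitivity (\sum_x \sum_(s : {ffun L -> A}) lift_weight x * gibbs_spec (Psi x) s * h x).
  apply: eq_bigr => x _; rewrite -[LHS]mulr1 -(gibbs_spec_sum L (Psi x)) mulr_sumr.
  by apply: eq_bigr => s _; ring.
rewrite pair_bigA /=; apply: eq_bigr => -[x s] _ /=.
by rewrite ovov ovK gibbs_spec_ov mulrA balance.
Qed.

End Local.

Section Indicator.
Context (R : realType) (T : Type).

Definition ind (C : set T) (w : T) : R := (`[< C w >])%:R.

Lemma ind_ge0 C w : 0 <= ind C w.
Proof. by rewrite /ind; case: asbool. Qed.

Lemma ind_le1 C w : ind C w <= 1.
Proof. by rewrite /ind; case: asbool. Qed.

Lemma ind1 (C : set T) w : C w -> ind C w = 1.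
Proof. by move=> /asboolP Cw; rewrite /ind Cw. Qed.

Lemma ind0 (C : set T) w : ~ C w -> ind C w = 0.
Proof. by move=> /asboolPn/negPf Cw; rewrite /ind Cw. Qed.

Lemma indU (C C' : set T) w : C `&` C' = set0 ->
  ind (C `|` C') w = ind C w + ind C' w.
Proof.
move=> CC'; have [Cw|nC] := pselect (C w).
  rewrite (@ind1 (C `|` C')); last by left.
  rewrite (@ind1 C)// ind0 ?addr0// => C'w.
  by have : (C `&` C') w by []; rewrite CC'.
rewrite (@ind0 C)// add0r; have [C'w|nC'] := pselect (C' w).
  by rewrite !ind1//; right.
by rewrite !ind0// => -[].
Qed.

End Indicator.

Section FiniteVolume.
Context (R : realType) (W : countType) (adj : rel W) (A : alphabetType).
Hypothesis adj_sym : symmetric adj.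
Hypothesis Ball_fin : forall D v, finite_set (Ball adj D v).
Context (D : nat) (psi : potential R adj A D).
Implicit Types (L : {fset W}) (w : W -> A).

Lemma pot_at_overwrite L (s : {ffun L -> A}) w v : ~ nbh adj D [set` L] v ->
  pot_at psi v (overwrite s w) = pot_at psi v w.
Proof.
move=> nv; apply: pot_at_eq => u vu; apply: overwrite_out; apply/negP => uL.
by apply: nv; apply/nbhP; exists u => //; apply: Ball_sym.
Qed.

(** The specification is consistent: resampling the smaller volume [L0]
   preserves the Gibbs law in [L]. *)
Lemma finite_consistency L0 L w (h : (W -> A) -> R) : {subset L0 <= L} ->
  \sum_(x : {ffun L -> A}) gibbs_spec psi w x * h (overwrite x w) =
  \sum_(x : {ffun L -> A}) gibbs_spec psi w x *
    \sum_(s : {ffun L0 -> A}) gibbs_spec psi (overwrite x w) s * h (overwrite s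
      (overwrite x w)).
Proof.
move=> L0L.
pose Psi (x : {ffun L -> A}) := overwrite x w.
pose ov (s : {ffun L0 -> A}) (x : {ffun L -> A}) :=
  restriction L (overwrite s (overwrite x w)).
have PsiE s x : Psi (ov s x) = overwrite s (Psi x).
  apply/funext => v; rewrite /Psi /ov {1}/overwrite; case: insubP => [u _ uv|vL].
    by rewrite ffunE uv.
  by rewrite !overwrite_out//; apply: contra vL; exact: L0L.
pose rest (x : {ffun L -> A}) : R :=
  \sum_(v \in nbh adj D [set` L] `&` ~` nbh adj D [set` L0]) pot_at psi v (Psi x).
have Esplit w' : energy psi L w' = energy psi L0 w' +
    \sum_(v \in nbh adj D [set` L] `&` ~` nbh adj D [set` L0]) pot_at psi v w'.
  rewrite /energy (fsbigID (nbh adj D [set` L0])); last exact: nbh_fin.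
  congr (_ + _); apply: eq_fsbigl; rewrite predeqE => v; split => [[]//|vL0].
  split=> //; move: vL0 => /nbhP[u uL0 uv]; apply/nbhP; exists u => //.
  exact: L0L.
have ovov s s' x : ov s (ov s' x) = ov s x.
  by rewrite /ov -/(Psi _) PsiE overwrite_overwrite.
have ovK x : ov (restriction L0 (Psi x)) x = x.
  by rewrite /ov -/(Psi x) overwrite_restriction /Psi restriction_overwrite.
have restE s x : rest (ov s x) = rest x.
  rewrite /rest PsiE; apply: eq_fsbigr => v /set_mem[_ nv].
  exact: pot_at_overwrite.
pose Z := \sum_(s' : {ffun L -> A}) expR (- energy psi L (overwrite s' w)).
have PsiE' s x u : nbh adj (2 * D) [set` L0] u ->
  Psi (ov s x) u = overwrite s (Psi x) u by rewrite PsiE.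
have lift_weightE x : expR (- energy psi L (Psi x)) =
  expR (- (energy psi L0 (Psi x) + rest x)) by rewrite -Esplit.
have HB := @heat_bath _ _ _ _ D psi L0 {ffun L -> A} Psi ov rest
  (fun x => expR (- energy psi L (Psi x))) PsiE' ovov ovK restE lift_weightE
  (fun x => h (Psi x)).
move: HB => /(congr1 (fun y => y / Z)).
have gE x : gibbs_spec psi w x = expR (- energy psi L (Psi x)) / Z by [].
rewrite !mulr_suml => HB.
transitivity (\sum_(x : {ffun L -> A}) expR (- energy psi L (Psi x)) * h (Psi x) / Z).
  by apply: eq_bigr => x _; rewrite gE; ring.
rewrite HB; apply: eq_bigr => x _; rewrite gE -!mulrA; congr (_ * _); rewrite mulrC.
  by congr (_ * _); apply: eq_bigr => s _; rewrite PsiE.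
Qed.

Definition gibbs_kernel L w (C : set (W -> A)) : R :=
  \sum_(s : {ffun L -> A}) gibbs_spec psi w s * ind R C (overwrite s w).

Lemma gibbs_kernel_ge0 L w C : 0 <= gibbs_kernel L w C.
Proof. by apply: sumr_ge0 => s _; rewrite mulr_ge0 ?gibbs_spec_ge0 ?ind_ge0. Qed.

Lemma gibbs_kernelT L w : gibbs_kernel L w setT = 1.
Proof.
by rewrite -(gibbs_spec_sum psi L w); apply: eq_bigr => s _; rewrite ind1// mulr1.
Qed.

Lemma gibbs_kernelU L w C C' : C `&` C' = set0 -> gibbs_kernel L w (C `|` C') =
  gibbs_kernel L w C + gibbs_kernel L w C'.
Proof.
move=> CC'; rewrite -big_split; apply: eq_bigr => s _ /=.
by rewrite indU// mulrDr.
Qed.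

Lemma gibbs_kernel_le1 L w C : gibbs_kernel L w C <= 1.
Proof.
rewrite -(gibbs_spec_sum psi L w); apply: ler_sum => s _.
by rewrite ler_piMr ?gibbs_spec_ge0 ?ind_le1.
Qed.

(** The Gibbs property of the finite-volume law, in the form that survives a
   limit of growing volumes [L]. *)
Lemma gibbs_kernel_dlr L0 L w (s : {ffun L0 -> A}) (t : bdry adj (2 * D) [set` L0] -> A) :
  {subset L0 <= L} ->
  let S := [set w : W -> A | [ffun u : L0 => w (val u)] = s] in
  let T := [set w : W -> A | pr w = t] in
  gibbs_kernel L w (S `&` T) =
  weight psi s t / (\sum_(s' : {ffun L0 -> A}) weight psi s' t) * gibbs_kernel L w T.
Proof.
move=> L0L S T; rewrite /gibbs_kernel (finite_consistency _ _ L0L) mulr_sumr.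
apply: eq_bigr => x _; rewrite mulrCA; congr (_ * _).
set y := overwrite x w.
have TE (s' : {ffun L0 -> A}) : T (overwrite s' y) <-> T y.
  rewrite /T /=; suff -> : pr (X := bdry adj (2 * D) [set` L0]) (overwrite s' y) =
    pr (X := bdry adj (2 * D) [set` L0]) y by [].
  apply/funext => u; rewrite /pr overwrite_out//.
  by have [/= /negP] := set_valP u.
have SE (s' : {ffun L0 -> A}) : S (overwrite s' y) <-> s' = s
  by rewrite /S /= -/(restriction L0 _) restriction_overwrite.
have [Ty|nTy] := pselect (T y); last first.
  rewrite (ind0 R nTy) mulr0 big1// => s' _.
  by rewrite ind0 ?mulr0// => -[_ /TE].
rewrite (ind1 R Ty) mulr1 (bigD1 s) //= big1 => [|s' s's].
  rewrite addr0 ind1 ?mulr1; last by split; [apply/SE|apply/TE].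
  by rewrite -Ty gibbs_spec_weight.
by rewrite ind0 ?mulr0// => -[/SE s'E _]; rewrite s'E eqxx in s's.
Qed.

Lemma finite_determined (F : set W) (C : set (W -> A)) : finite_set F ->
  (forall w w', (forall v, F v -> w v = w' v) -> C w -> C w') ->
  exists k, determined k C.
Proof.
move=> fF dep; exists (\max_(v <- fset_set F) (choice.pickle v).+1)%N.
move=> w w' ww'; apply: dep => v Fv; apply: ww'.
apply: (@leq_bigmax_seq _ _ (fun _ => true) (fun v => (choice.pickle v).+1)) => //.
by rewrite in_fset_set// mem_set.
Qed.

End FiniteVolume.

(** * Uniqueness makes finite-volume Gibbs measures uniformly close *)

Section Uniform.
Import numFieldNormedType.Exports.
Context (R : realType) (W : countType) (adj : rel W) (A : alphabetType).
Hypothesis adj_sym : symmetric adj.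
Hypothesis Ball_fin : forall D v, finite_set (Ball adj D v).
Context (D : nat) (psi : potential R adj A D).
Context (root_ball : nat -> {fset W}).
Hypothesis root_ball_exhaust : forall v, \forall r \near \oo, v \in root_ball r.

Lemma root_ball_exhaust_fset (L : {fset W}) : \forall r \near \oo, {subset L <=
  root_ball r}.
Proof.
have : \forall r \near \oo, forall u : L, val u \in root_ball r.
  by apply: filter_forall => u; exact: root_ball_exhaust.
by apply: filterS => r LR v vL; exact: (LR [` vL]%fset).
Qed.

(** Compactness. Otherwise there are boundary conditions for arbitrarily large
   [r] that violate the estimate. An ultralimit of the corresponding laws is
   finitely additive, extends to a probability by [finadd_extension], is a Gibbs
   measure by [gibbs_kernel_dlr], and still differs from [nu] on [C], which
   contradicts uniqueness. *)
Lemma unique_uniform (nu : probability (config W A) R) :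
  is_unique_gibbs psi nu -> forall k (C : set (config W A)), determined k C ->
  forall delta : R, 0 < delta ->
  \forall r \near \oo, forall w, `|gibbs_kernel psi (root_ball r) w C - fine (nu C)| <=
    delta.
Proof.
move=> [nu_gibbs nu_uniq] k C detC delta delta0; apply: contrapT => nnear.
have freq n : exists rw : nat * (W -> A), (n <= rw.1)%N /\
    delta < `|gibbs_kernel psi (root_ball rw.1) rw.2 C - fine (nu C)|.
  apply: contrapT => nex; apply: nnear; exists n => // r /= nr w.
  by rewrite leNgt; apply/negP => lt; apply: nex; exists (r, w).
have [rw rwP] := choice freq.
pose la n (C' : set (W -> A)) := gibbs_kernel psi (root_ball (rw n).1) (rw n).2 C'.
have [U [Uadd Umul Ule]] := @ultralimit_ex R.
have bla C' : bounded_seq (la ^~ C').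
  by exists 1 => n; rewrite ger0_norm ?gibbs_kernel_ge0 ?gibbs_kernel_le1.
have bcst c : bounded_seq (fun _ => c : R) by exists `|c|.
have U0 : U (fun _ => 0) = 0.
  have := Uadd _ _ (bcst 0) (bcst 0).
  by rewrite (_ : (fun=> 0 + 0) = fun=> 0); [lra|apply/funext => n; rewrite addr0].
have Ucst c : U (fun _ => c) = c.
  have h c' : U (fun _ => c') <= c' by apply: Ule => //; exact: nearW.
  have := Uadd _ _ (bcst c) (bcst (- c)).
  rewrite (_ : (fun=> c + - c) = fun=> 0); last by apply/funext => n; rewrite subrr.
  by rewrite U0; have := h c; have := h (- c); lra.
have UN u : bounded_seq u -> U (fun n => - u n) = - U u.
  move=> bu; have bN : bounded_seq (fun n => - u n).
    by case: bu => M uM; exists M => n; rewrite normrN.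
  have := Uadd _ _ bu bN.
  rewrite (_ : (fun n => u n + - u n) = fun=> 0); last by apply/funext => n; rewrite subrr.
  by rewrite U0; lra.
have Uge u c : bounded_seq u -> (\forall n \near \oo, c <= u n) -> c <= U u.
  move=> bu cu; rewrite -lerN2 -UN//; apply: Ule; last first.
    by apply: filterS cu => n; rewrite lerN2.
  by case: bu => M uM; exists M => n; rewrite normrN.
have Ueq u v : bounded_seq u -> bounded_seq v ->
    (\forall n \near \oo, u n = v n) -> U u = U v.
  move=> bu bv uv.
  have bN : bounded_seq (fun n => - v n).
    by case: bv => M uM; exists M => n; rewrite normrN.
  have bB : bounded_seq (fun n => u n + - v n).
    case: bu bN => M uM [N vN]; exists (M + N) => n.
    by apply: le_trans (ler_normD _ _) _; apply: lerD.
  have : U (fun n => u n + - v n) = 0.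
    apply/eqP; rewrite eq_le Ule//= ?Uge//.
      by apply: filterS uv => n ->; rewrite subrr.
    by apply: filterS uv => n ->; rewrite subrr.
  by rewrite Uadd// UN//; lra.
pose l C' := U (la ^~ C').
have l_ge0 C' : 0 <= l C' by apply: Uge => //; apply: nearW => n; exact: gibbs_kernel_ge0.
have lT : l setT = 1.
  by rewrite -[RHS]Ucst; apply: Ueq => //; apply: nearW => n; exact: gibbs_kernelT.
have lU C1 C2 : C1 `&` C2 = set0 -> l (C1 `|` C2) = l C1 + l C2.
  move=> C12; rewrite -Uadd//; apply: Ueq => //.
    by exists 2 => n; rewrite -gibbs_kernelU// ger0_norm ?gibbs_kernel_ge0//;
      have := gibbs_kernel_le1 psi (root_ball (rw n).1) (rw n).2 (C1 `|` C2); lra.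
  by apply: nearW => n; exact: gibbs_kernelU.
have [nu' nu'E] := finadd_extension l_ge0 lT lU.
have nu'_gibbs : is_gibbs psi nu'.
  move=> L s t S T; rewrite /= => T0.
  have fB : finite_set (nbh adj (2 * D) [set` L]) by exact: nbh_fin.
  have [kT dT] : exists kT, determined kT T.
    apply: (finite_determined fB) => w w' ww' Tw.
    apply: etrans Tw; apply/funext => u; rewrite /pr.
    by rewrite ww'//; right; exact: set_valP.
  have [kST dST] : exists kST, determined kST (S `&` T).
    apply: (finite_determined fB) => w w' ww' [Sw Tw]; split.
      by apply: etrans Sw; apply/ffunP => u; rewrite !ffunE ww'//; left; exact: valP.
    by apply: etrans Tw; apply/funext => u; rewrite /pr ww'//; right; exact: set_valP.
  rewrite (nu'E _ _ dT) (nu'E _ _ dST) /=.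
  rewrite (nu'E _ _ dT) lte_fin in T0.
  set c := weight psi s t / _.
  suff -> : l (S `&` T) = c * l T by rewrite mulfK// gt_eqF.
  have -> : c * l T = U (fun n => c * la n T) by rewrite (Umul _ _ (bcst c)) ?Ucst.
  apply: Ueq => //.
    exists (`|c| * 1) => n; rewrite normrM ler_wpM2l// ger0_norm ?gibbs_kernel_ge0//.
    exact: gibbs_kernel_le1.
  have [N _ NL] := root_ball_exhaust_fset L; exists N => // n /= Nn.
  rewrite /la /c gibbs_kernel_dlr//; apply: NL => /=.
  by apply: leq_trans Nn _; case: (rwP n).
have lC : l C = fine (nu C).
  by rewrite -(nu_uniq nu' nu'_gibbs _ (determined_measurable detC)) (nu'E _ _ detC).
pose c := fine (nu C).
have bC : bounded_seq (fun n => la n C + - c).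
  case: (bla C) => M uM; exists (M + `|c|) => n.
  by apply: le_trans (ler_normD _ _) _; rewrite normrN lerD.
have UC : U (fun n => la n C + - c) = 0.
  by rewrite Uadd// Ucst -/(l C) lC subrr.
(* The limit is multiplicative: squaring handles the absolute value. *)
have : delta ^+ 2 <= U (fun n => (la n C + - c) * (la n C + - c)).
  apply: Uge.
    case: bC => M uM; exists (M * M) => n; rewrite normrM.
    by apply: ler_pM.
  apply: nearW => n; have [_ /ltW dn] := rwP n.
  rewrite -expr2 -[X in _ <= X]real_normK ?num_real//.
  by rewrite ler_sqr ?nnegrE// ltW.
by rewrite Umul// UC mulr0 leNgt exprn_gt0.
Qed.

End Uniform.

(** * Gibbs weights on finite coverings *)

Section CoverBalls.
Context (V : finType) (e : rel V) (o : V).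
Hypothesis e_sym : symmetric e.
Local Notation T := (ucover e o).
Implicit Types p q : T.

Lemma size_uadj p q : uadj p q -> (size (val q) <= (size (val p)).+1)%N.
Proof.
case/orP => /existsP[x /eqP ->]; rewrite size_rcons; first by [].
exact/leqW/leqnSn.
Qed.

Lemma Ball_size D p q : Ball (@uadj V e o) D p q ->
  (size (val q) <= size (val p) + D)%N.
Proof.
move=> [s [ps <- sD]]; apply: leq_trans (leq_add (leqnn _) sD).
elim: s p ps {sD} => [|x s IH] p /=; first by rewrite addn0.
case/andP => px xs; apply: leq_trans (IH _ xs) _.
by rewrite addnS -addSn leq_add2r size_uadj.
Qed.

Lemma finite_size r : finite_set [set p : T | (size (val p) <= r)%N].
Proof.
apply: (@sub_finite_set _ _ ((fun b : r.-bseq V => insubd (uroot e o) (val b)) @` setT)).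
  by move=> p /= pr; exists (short r (val p)) => //; rewrite val_short// valKd.
exact/finite_image/finite_finset.
Qed.

Lemma uBall_fin D p : finite_set (Ball (@uadj V e o) D p).
Proof. by apply: sub_finite_set (finite_size (size (val p) + D)) => q /Ball_size. Qed.

Definition root_ball r : {fset T} := fset_set [set p : T | (size (val p) <= r)%N].

Lemma mem_root_ball r p : (p \in root_ball r) = (size (val p) <= r)%N.
Proof. by rewrite in_fset_set ?mem_setE//; exact: finite_size. Qed.

Lemma root_ball_exhaust p : \forall r \near \oo, p \in root_ball r.
Proof. by exists (size (val p)) => // r /= pr; rewrite mem_root_ball. Qed.

Lemma nbh_root_ball D r p : nbh (@uadj V e o) D [set` root_ball r] p ->
  (size (val p) <= r + D)%N.
Proof.
move=> /nbhP[q /=]; rewrite mem_root_ball => qr /Ball_size.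
by move=> h; apply: leq_trans h _; rewrite leq_add2r.
Qed.

Lemma Ball_deck D (g : deck e o) p q : Ball (@uadj V e o) D p q ->
  Ball (@uadj V e o) D (g p) (g q).
Proof.
move=> [s [ps <- sD]]; exists (map g s); split; rewrite ?size_map//; last first.
  by rewrite last_map.
by elim: s p ps {sD} => //= x s IH p /andP[px xs]; rewrite deck_adj px IH.
Qed.

End CoverBalls.

Section FiniteLift.
Context (R : realType) (V : finType) (e : rel V) (o : V).
Hypothesis e_sym : symmetric e.
Local Notation T := (ucover e o).
Local Notation adj := (@uadj V e o).
Context (A : alphabetType) (D : nat) (psi : potential R adj A D).
Hypothesis psi_inv : invariant_potential psi.
Context (vlift : V -> T) (vliftP : forall v, uproj (vlift v) = v).
Context (X : finType) (st : V -> V -> X -> X).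
Hypothesis stK : forall u v, e u v -> cancel (st u v) (st v u).

(** The covering map from the tree to the finite graph with vertex set [V *
   X], depending on the image [(o, j)] of the root. *)
Definition cover_map (j : X) (p : T) : V * X := (uproj p, trace st j p).

Definition fibre_index (z : V * X) : X := invF (trace_inj stK (p := vlift z.1)) z.2.

Lemma fibre_indexP z : cover_map (fibre_index z) (vlift z.1) = z.
Proof.
case: z => v x; rewrite /cover_map /fibre_index vliftP /=; congr (_, _).
exact: (f_invF (trace_inj stK (p := vlift v)) x).
Qed.

Lemma cover_map_deck j (g : deck e o) p : cover_map j (g p) =
  cover_map (trace st j (g (uroot e o))) p.
Proof. by rewrite /cover_map deck_proj (trace_deck e_sym stK). Qed.

(** Two lifts of the covering map that meet at a point differ by a deck
   transformation, because deck transformations are transitive on fibres. *)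
Lemma cover_map_meet j k p q : cover_map j p = cover_map k q -> exists g : deck e o,
  g q = p /\ forall q', cover_map k q' = cover_map j (g q').
Proof.
move=> [pq jk]; have [g gq] := deck_trans e_sym (esym pq).
exists g; split=> // q'; rewrite cover_map_deck.
suff -> : k = trace st j (g (uroot e o)) by [].
by apply: (trace_inj stK (p := q)); rewrite /= -(trace_deck e_sym stK) gq.
Qed.

Implicit Types x : {ffun V * X -> A}.

Definition pull (j : X) x : T -> A := fun p => x (cover_map j p).

(** The potential at a vertex of the finite graph, computed on the tree from
   any copy of that vertex; [site_pot_cover_map] shows that the copy is
   irrelevant, by invariance. *)
Definition site_pot (z : V * X) x : R :=
  pot_at psi (vlift z.1) (pull (fibre_index z) x).

Lemma site_pot_cover_map j p x : site_pot (cover_map j p) x = pot_at psi p (pull j x).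
Proof.
have := fibre_indexP (cover_map j p); rewrite /site_pot.
move: (fibre_index _) => k /esym/cover_map_meet[g [gp kE]].
have := psi_inv g (vlift (uproj p)) (pull k x); rewrite gp => <-.
congr pot_at; apply/funext => q.
by rewrite /Defs.act /pull kE deck_invK.
Qed.

Definition lift_weight x : R := expR (- \sum_z site_pot z x).

(** Where the neighbourhood of [L] embeds, the finite graph looks like the
   tree to the potential, and the heat bath in the image of [L] is the one of the
   tree. It does not affect an observable [h] that reads the finite graph away
   from that image. *)
Lemma lift_heat_bath j (L : {fset T}) :
  {in nbh adj (2 * D) [set` L] &, injective (cover_map j)} ->
  forall (F : {fset T}) k, (forall p q, p \in F -> q \in L ->
    cover_map k p != cover_map j q) ->
  forall (f : (T -> A) -> R) (h : (T -> A) -> R),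
  (forall w w', (forall p, nbh adj (2 * D) [set` L] p -> w p = w' p) -> f w = f w') ->
  (forall w w', {in F, w =1 w'} -> h w = h w') ->
  \sum_x lift_weight x * (f (pull j x) * h (pull k x)) =
  \sum_x lift_weight x * ((\sum_(s : {ffun L ->
    A}) gibbs_spec psi (pull j x) s * f (overwrite s (pull j x)))
                 * h (pull k x)).
Proof.
move=> inj F k Fk f h fdep hdep.
have LN u : u \in L -> nbh adj (2 * D) [set` L] u by left.
pose ov (s : {ffun L -> A}) x : {ffun V * X -> A} :=
  [ffun z => if [pick u : L | cover_map j (val u) == z] is Some u then s u else x z].
have ovE s x u : nbh adj (2 * D) [set` L] u ->
    pull j (ov s x) u = overwrite s (pull j x) u.
  move=> uN; rewrite /pull ffunE /overwrite.
  case: pickP => [u' /eqP u'u|nou].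
    have <- : val u' = u by apply: inj u'u; apply: mem_set => //; apply: LN; exact: valP.
    by rewrite valK.
  case: insubP => // u' _ u'u.
  by have := nou u'; rewrite u'u eqxx.
have ovov s s' x : ov s (ov s' x) = ov s x.
  by apply/ffunP => z; rewrite !ffunE; case: pickP.
have ovK x : ov (restriction L (pull j x)) x = x.
  by apply/ffunP => z; rewrite ffunE; case: pickP => // u /eqP <-; rewrite ffunE.
pose N1 := fset_set (nbh adj D [set` L]).
have fN1 : finite_set (nbh adj D [set` L]) by apply: nbh_fin; exact: uBall_fin.
have N1P v : (v \in N1) = (v \in nbh adj D [set` L]) by rewrite in_fset_set.
have N1N v : v \in N1 -> v \in nbh adj (2 * D) [set` L].
  rewrite N1P => /set_mem/nbhP[u Lu uv]; apply/mem_set/nbhP; exists u => //.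
  by apply: Ball_le uv; rewrite leq_pmull.
pose s1 := [seq cover_map j v | v <- N1].
have us1 : uniq s1.
  rewrite map_inj_in_uniq ?fset_uniq// => v v' /N1N vN /N1N v'N.
  exact: inj.
pose rest x : R := \sum_(z | z \notin s1) site_pot z x.
have Esplit x : \sum_z site_pot z x = energy psi L (pull j x) + rest x.
  rewrite (bigID (fun z => z \in s1)) /=; congr (_ + _).
  rewrite -big_uniq//= big_map /energy fsbig_finite//.
  by apply: eq_bigr => v _; rewrite site_pot_cover_map.
have restE s x : rest (ov s x) = rest x.
  apply: eq_bigr => z zs; apply: pot_at_eq => q vq; rewrite /pull ffunE.
  case: pickP => // u /eqP uE; case/negP: zs.
  have [g [gq gE]] := cover_map_meet uE.
  rewrite -(fibre_indexP z) gE; apply: map_f; rewrite N1P.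
  apply/mem_set/nbhP; exists (val u); first exact: valP.
  by rewrite -gq; apply/(Ball_sym (@uadj_sym _ _ _))/Ball_deck.
have lift_weightE x : lift_weight x = expR (- (energy psi L (pull j x) + rest x))
  by rewrite -Esplit.
rewrite (heat_bath ovE ovov ovK restE lift_weightE (fun x => f (pull j x) * h (pull k x))).
apply: eq_bigr => x _; congr (_ * _); rewrite mulr_suml.
apply: eq_bigr => s _; rewrite -mulrA; congr (_ * (_ * _)).
  by apply: fdep => p; exact: ovE.
apply: hdep => p pF; rewrite /pull ffunE; case: pickP => // u /eqP uE.
by have := Fk _ _ pF (valP u); rewrite uE eqxx.
Qed.

End FiniteLift.

(** * Second moment: a configuration with the right frequencies *)

Section SecondMoment.
Context (R : realType) (V : finType) (e : rel V) (o : V).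
Hypothesis e_sym : symmetric e.
Local Notation T := (ucover e o).
Local Notation adj := (@uadj V e o).
Context (A : alphabetType) (D : nat) (psi : potential R adj A D).
Hypothesis psi_inv : invariant_potential psi.
Context (vlift : V -> T) (vliftP : forall v, uproj (vlift v) = v).
Context (X : finType) (st : V -> V -> X -> X).
Hypothesis stK : forall u v, e u v -> cancel (st u v) (st v u).

Local Notation lift_weight := (lift_weight psi vlift stK).
Local Notation pull j x := (pull st j x : T -> A).

Context (L F : {fset T}).
Hypothesis FL : {subset F <= L}.
Hypothesis inj : forall j, {in nbh adj (2 * D) [set` L] &, injective (cover_map st j)}.

Definition depends (C : set (T -> A)) :=
  forall w w', {in F, w =1 w'} -> C w -> C w'.

Lemma ind_depends C w w' : depends C -> {in F, w =1 w'} -> ind R C w = ind R C w'.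
Proof.
move=> dC ww'; rewrite /ind; congr (_ %:R); congr nat_of_bool.
by apply: asbool_equiv_eq; split; apply: dC => // p pF; rewrite ww'.
Qed.

Definition partition_fun : R := \sum_x lift_weight x.

Lemma lift_weight_gt0 x : 0 < lift_weight x. Proof. exact: expR_gt0. Qed.

Lemma partition_gt0 : 0 < partition_fun.
Proof.
rewrite /partition_fun (bigD1 [ffun=> point]) //= ltr_wpDr ?lift_weight_gt0//.
by apply: sumr_ge0 => x _; exact/ltW/lift_weight_gt0.
Qed.

Section OneEvent.
Context (C : set (T -> A)) (c delta : R).
Hypothesis dC : depends C.
Hypothesis c01 : 0 <= c <= 1.
Hypothesis delta_ge0 : 0 <= delta.
Hypothesis unifC : forall w, `|gibbs_kernel psi L w C - c| <= delta.

Definition dev j x : R := ind R C (pull j x) - c.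

Lemma dev_le1 j x : `|dev j x| <= 1.
Proof.
rewrite ler_norml /dev.
case/andP: c01 => c0 c1; move: (ind_ge0 R C (pull j x)) (ind_le1 R C (pull j x)).
by move: (ind _ _ _) => t t0 t1; apply/andP; split; lra.
Qed.

(** If the place read from [k] avoids the image of [L] read from [j],
   averaging over that image replaces the first factor by a deviation of the
   Gibbs kernel, which is at most [delta]. *)
Lemma far_pair j k : (forall p q, p \in F -> q \in L ->
  cover_map st k p != cover_map st j q) ->
  \sum_x lift_weight x * (dev j x * dev k x) <= delta * partition_fun.
Proof.
move=> Fk; pose f w := ind R C w - c.
rewrite (@lift_heat_bath _ _ _ _ e_sym _ _ _ psi_inv _ vliftP _ _ stK j L (@inj j)
  F k Fk f f); first last.
- by move=> w w' ww'; rewrite /f (ind_depends dC ww').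
- move=> w w' ww'; rewrite /f (@ind_depends _ w w')// => p pF.
  by apply: ww'; left; exact: FL.
rewrite /partition_fun mulr_sumr; apply: ler_sum => x _.
rewrite mulrC ler_wpM2r ?(ltW (lift_weight_gt0 _))//.
have -> : \sum_(s : {ffun L -> A}) gibbs_spec psi (pull j x) s *
    (ind R C (overwrite s (pull j x)) - c) = gibbs_kernel psi L (pull j x) C - c.
  under eq_bigr do rewrite mulrBr.
  by rewrite sumrB -mulr_suml gibbs_spec_sum mul1r.
apply: le_trans (ler_norm _) _; rewrite normrM -[leRHS]mulr1.
by apply: ler_pM => //; exact: dev_le1.
Qed.

Lemma any_pair j k : \sum_x lift_weight x * (dev j x * dev k x) <= partition_fun.
Proof.
apply: ler_sum => x _; rewrite -[leRHS]mulr1 ler_wpM2l ?(ltW (lift_weight_gt0 _))//.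
apply: le_trans (ler_norm _) _; rewrite normrM -[leRHS]mulr1.
by apply: ler_pM => //; exact: dev_le1.
Qed.

Context (n : nat) (n_gt0 : (0 < n)%N) (b : 'I_n -> X) (b_inj : injective b).

Definition empirical x : R := (\sum_i ind R C (pull (b i) x)) / n%:R.

(** The number of obstructions to the hypothesis of [far_pair] for the copies
   [i] and [i']. *)
Definition encounters (i i' : 'I_n) : nat :=
  \sum_(p <- F) \sum_(q <- L) (cover_map st (b i') p == cover_map st (b i) q).

(** For given [p] in [F] and [q] in [L] at most one copy [i'] can interfere
   with [i], because the copies start at distinct points. The bound does not
   depend on [n]. *)
Lemma encounters_sum i : (\sum_i' encounters i i' <= #|` F| * #|` L|)%N.
Proof.
rewrite /encounters exchange_big /= -sum1_size big_distrl /= leq_sum// => p _.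
rewrite exchange_big /= mul1n -sum1_size leq_sum// => q _.
have -> : (\sum_i1 (cover_map st (b i1) p == cover_map st (b i) q))%N =
    #|[pred i1 | cover_map st (b i1) p == cover_map st (b i) q]|.
  by rewrite -sum1_card [RHS]big_mkcond.
apply/card_le1_eqP => i1 i2; rewrite !inE => /eqP i1q /eqP i2q.
apply: b_inj; apply: (trace_inj stK (p := p)) => /=.
by move: i1q; rewrite -i2q => -[].
Qed.

Lemma pair_le i i' : \sum_x lift_weight x * (dev (b i) x * dev (b i') x) <=
  (delta + (encounters i i')%:R) * partition_fun.
Proof.
(* An interfering pair has no decorrelation, but it is paid for by [encounters]. *)
have [m0|] := eqVneq (encounters i i') 0%N.
  rewrite m0 addr0; apply: far_pair => p q pF qL; apply/negP => pq.
  have : (0 < encounters i i')%N.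
    by rewrite /encounters (big_rem p) //= (big_rem q) //= pq.
  by rewrite m0.
rewrite -lt0n => m0; apply: le_trans (any_pair _ _) _.
rewrite -[leLHS]mul1r ler_wpM2r ?(ltW partition_gt0)//.
by rewrite ler_wpDl// ler1n.
Qed.

Lemma second_moment : \sum_x lift_weight x * (empirical x - c) ^+ 2 <=
  (delta + (#|` F| * #|` L|)%:R / n%:R) * partition_fun.
Proof.
have n0 : (0 : R) < n%:R by rewrite ltr0n.
have empE x : empirical x - c = (\sum_i dev (b i) x) / n%:R.
  rewrite /empirical /dev sumrB sumr_const card_ord mulrBl -[c *+ n]mulr_natr.
  by rewrite mulfK ?gt_eqF.
have sqE x : lift_weight x * (empirical x - c) ^+ 2 =
    \sum_i \sum_i' (lift_weight x * (dev (b i) x * dev (b i') x) / n%:R ^+ 2).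
  rewrite empE expr_div_n expr2 big_distrlr /= mulrA mulr_sumr mulr_suml.
  by apply: eq_bigr => i _; rewrite mulr_sumr mulr_suml.
under eq_bigr do rewrite sqE.
rewrite exchange_big /=; under eq_bigr do rewrite exchange_big /=.
apply: (@le_trans _ _ (\sum_i \sum_i'
    ((delta + (encounters i i')%:R) * partition_fun / n%:R ^+ 2))).
  apply: ler_sum => i _; apply: ler_sum => i' _; rewrite -mulr_suml.
  by rewrite ler_wpM2r ?pair_le// invr_ge0 sqr_ge0.
have sumE i : \sum_i' ((delta + (encounters i i')%:R) * partition_fun / n%:R ^+ 2) =
    (delta * n%:R + (\sum_i' encounters i i')%:R) * (partition_fun / n%:R ^+ 2).
  transitivity (\sum_i' ((delta + (encounters i i')%:R) * (partition_fun / n%:R ^+ 2))).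
    by apply: eq_bigr => i' _; rewrite mulrA.
  by rewrite -mulr_suml big_split /= sumr_const card_ord mulr_natr natr_sum.
under eq_bigr do rewrite sumE.
apply: (@le_trans _ _ (\sum_(i < n) ((delta * n%:R + (#|` F| * #|` L|)%:R) *
    (partition_fun / n%:R ^+ 2)))).
  apply: ler_sum => i _; rewrite ler_wpM2r ?lerD2l ?ler_nat ?encounters_sum//.
  by rewrite divr_ge0 ?sqr_ge0// ltW// partition_gt0.
rewrite sumr_const card_ord -[X in X <= _]mulr_natr.
rewrite le_eqVlt; apply/orP; left; apply/eqP; field.
by rewrite gt_eqF.
Qed.

End OneEvent.

(** By [second_moment] the average under the Gibbs weights of the total
   deviation is at most the right-hand side, so some configuration does at least
   as well. *)
Lemma good_config (I K : finType) (C : I -> set (T -> A)) (c : I -> R)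
    (delta eta : R) (n : nat) (b : K -> 'I_n -> X) :
  (forall l, depends (C l)) -> (forall l, 0 <= c l <= 1) -> 0 <= delta ->
  (forall l w, `|gibbs_kernel psi L w (C l) - c l| <= delta) ->
  (0 < n)%N -> (forall a, injective (b a)) -> 0 < eta ->
  delta + (#|` F| * #|` L|)%:R / n%:R <= eta ^+ 2 ->
  exists x, \sum_(a : K) \sum_(l : I) `|empirical (C l) (b a) x - c l| <=
    (#|K| * #|I|)%:R * eta.
Proof.
move=> dC c01 d0 unif n0 b_inj eta0 small.
set B := (#|K| * #|I|)%:R * eta; pose g x : R :=
  \sum_(a : K) \sum_(l : I) `|empirical (C l) (b a) x - c l|.
suff avg : \sum_x lift_weight x * g x <= B * partition_fun.
  apply: contrapT => nex; have : 0 < \sum_x lift_weight x * (g x - B).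
    rewrite (bigD1 [ffun=> point]) //=.
    have pos x : 0 < lift_weight x * (g x - B).
      rewrite mulr_gt0 ?lift_weight_gt0// subr_gt0 ltNge; apply/negP => gB.
      by apply: nex; exists x.
    by rewrite ltr_wpDr// sumr_ge0// => x _; exact/ltW.
  apply/negP; rewrite -leNgt; under eq_bigr do rewrite mulrBr.
  by rewrite sumrB -mulr_suml [_ * B]mulrC subr_le0.
have amgm (t : R) : `|t| <= eta / 2 + t ^+ 2 / (2 * eta).
  rewrite -[t ^+ 2]real_normK ?num_real//; move: `|t| => u.
  rewrite -subr_ge0; have -> : eta / 2 + u ^+ 2 / (2 * eta) - u =
    (u - eta) ^+ 2 / (2 * eta).
    by field; rewrite gt_eqF.
  by rewrite divr_ge0 ?sqr_ge0// mulr_ge0// ltW.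
have one a l : \sum_x lift_weight x * `|empirical (C l) (b a) x - c l| <=
  eta * partition_fun.
  apply: (@le_trans _ _ (\sum_x (lift_weight x * (eta / 2) +
      lift_weight x * (empirical (C l) (b a) x - c l) ^+ 2 / (2 * eta)))).
    apply: ler_sum => x _; rewrite -mulrA -mulrDr.
    by rewrite ler_wpM2l ?(ltW (lift_weight_gt0 _)).
  rewrite big_split /= -!mulr_suml -/partition_fun.
  have sm := second_moment (dC l) (c01 l) d0 (unif l) n0 (b_inj a).
  have Z0 := partition_gt0.
  have sm' : \sum_x lift_weight x * (empirical (C l) (b a) x - c l) ^+ 2 <=
    eta ^+ 2 * partition_fun.
    by apply: le_trans sm _; rewrite ler_wpM2r// ltW.
  apply: (@le_trans _ _ (partition_fun * (eta / 2) + eta ^+ 2 * partition_fun / (2 * eta))).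
    by rewrite lerD2l ler_wpM2r// invr_ge0 mulr_ge0// ltW.
  rewrite le_eqVlt; apply/orP; left; apply/eqP; field.
  by rewrite gt_eqF.
have -> : \sum_x lift_weight x * g x =
    \sum_(a : K) \sum_(l : I) \sum_x lift_weight x * `|empirical (C l) (b a) x - c l|.
  rewrite /g; under eq_bigr do rewrite mulr_sumr.
  rewrite exchange_big /=; apply: eq_bigr => a _.
  under eq_bigr do rewrite mulr_sumr.
  by rewrite exchange_big.
apply: (@le_trans _ _ (\sum_(a : K) \sum_(l : I) eta * partition_fun)).
  by apply: ler_sum => a _; apply: ler_sum => l _; exact: one.
rewrite /B !sumr_const -[X in X <= _]mulr_natl -[X in _ * X <= _]mulr_natl natrM.
by rewrite !mulrA.
Qed.

End SecondMoment.

(** * Continuity of entropy and local approximation of factor maps *)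

Section EntropyModulus.
Context (R : realType).

Lemma ln_le_sub1 (x : R) : 0 < x -> ln x <= x - 1.
Proof.
move=> x0; have : ln (1 + (x - 1)) <= x - 1 by apply: le_ln1Dx; lra.
by rewrite addrCA subrr addr0.
Qed.

(** Since x ln x has an infinite slope at 0, it is not Lipschitz there;
   allowing an error [eps] makes an affine bound possible, which is convenient to
   sum. *)
Lemma xlnx_modulus (y eps : R) : 0 <= y <= 1 -> 0 < eps ->
  exists2 C, 0 <= C & forall x, 0 <= x <= 1 ->
    `|x * ln x - y * ln y| <= eps + C * `|x - y|.
Proof.
move=> /andP[y0 y1] eps0; have [->|yn0] := eqVneq y 0.
  exists `|ln eps| => // x /andP[x0 x1]; rewrite mul0r !subr0 (ger0_norm x0).
  have [->|xn0] := eqVneq x 0; first by rewrite mul0r normr0 mulr0 addr0 ltW.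
  have {x0 xn0} x0 : 0 < x by rewrite lt_neqAle eq_sym xn0.
  rewrite ler0_norm; last by rewrite pmulr_rle0// ln_le0.
  have : ln (eps / x) <= eps / x - 1 by rewrite ln_le_sub1// divr_gt0.
  rewrite ln_div ?posrE// => h.
  have : x * (ln eps - ln x) <= x * (eps / x - 1) by rewrite ler_wpM2l// ltW.
  rewrite !mulrBr mulrCA divff ?gt_eqF// !mulr1 => h'.
  have : - (x * ln eps) <= `|ln eps| * x.
    by rewrite -mulrN mulrC ler_wpM2r ?(ltW x0)// -normrN ler_norm.
  lra.
have {y0 yn0} y0 : 0 < y by rewrite lt_neqAle eq_sym yn0.
have iy : 0 < y^-1 by rewrite invr_gt0.
exists (y^-1 + 1 + `|ln y|) => [|x /andP[x0 x1]].
  by rewrite !addr_ge0// ltW.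
have [->|xn0] := eqVneq x 0.
  rewrite mul0r !sub0r !normrN normrM (ger0_norm (ltW y0)).
  have : 0 <= (y^-1 + 1) * y by rewrite mulr_ge0 ?addr_ge0// ltW.
  move: `|ln y| => l; lra.
have {x0 xn0} x0 : 0 < x by rewrite lt_neqAle eq_sym xn0.
have -> : x * ln x - y * ln y = x * (ln x - ln y) + (x - y) * ln y by ring.
apply: le_trans (ler_normD _ _) _; rewrite [in X in _ + X <= _]normrM.
suff h : `|x * (ln x - ln y)| <= (y^-1 + 1) * `|x - y|.
  by move: h; lra.
rewrite ler_norml; apply/andP; split.
  have : ln (y / x) <= y / x - 1 by rewrite ln_le_sub1// divr_gt0.
  rewrite ln_div ?posrE// => h.
  have : x * (ln y - ln x) <= x * (y / x - 1) by rewrite ler_wpM2l// ltW.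
  rewrite [in X in _ <= X -> _]mulrBr mulrCA divff ?gt_eqF// !mulr1 => h'.
  have := ler_norm (- (x - y)); rewrite normrN => h1.
  have : 0 <= y^-1 * `|x - y| by rewrite mulr_ge0// ltW.
  lra.
have : ln (x / y) <= x / y - 1 by rewrite ln_le_sub1// divr_gt0.
rewrite ln_div ?posrE// => h.
have : x * (ln x - ln y) <= x * (x / y - 1) by rewrite ler_wpM2l// ltW.
have -> : x * (x / y - 1) = x * (y^-1 * (x - y)) by field; rewrite gt_eqF.
move=> h'; apply: (le_trans h').
apply: (@le_trans _ _ (x * (y^-1 * `|x - y|))).
  by rewrite ler_wpM2l ?(ltW x0)// ler_wpM2l ?ler_norm// ltW.
have : 0 <= y^-1 * `|x - y| by rewrite mulr_ge0// ltW.
move=> p; apply: (@le_trans _ _ (y^-1 * `|x - y|)).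
  by rewrite ler_piMl.
by rewrite ler_wpM2r// lerDl.
Qed.

Lemma entropy_modulus (Q : finType) (q : Q -> R) (eps : R) :
  (forall c, 0 <= q c <= 1) -> 0 < eps ->
  exists2 C, 0 <= C & forall p : Q -> R, (forall c, 0 <= p c <= 1) ->
    `|entropy p - entropy q| <= eps + C * \sum_c `|p c - q c|.
Proof.
move=> q01 eps0; pose e1 := eps / (#|Q|.+1)%:R.
have e10 : 0 < e1 by rewrite divr_gt0.
have /choice[C CP] : forall c, exists C, 0 <= C /\ forall x, 0 <= x <= 1 ->
    `|x * ln x - q c * ln (q c)| <= e1 + C * `|x - q c|.
  by move=> c; have [C C0 CP] := xlnx_modulus (q01 c) e10; exists C.
exists (\sum_c C c) => [|p p01]; first by apply: sumr_ge0 => c _; case: (CP c).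
rewrite /entropy opprK addrC -sumrB.
apply: le_trans (ler_norm_sum _ _ _) _.
apply: (@le_trans _ _ (\sum_c (e1 + (\sum_c C c) * `|p c - q c|))).
  apply: ler_sum => c _; have [C0 CcP] := CP c.
  rewrite distrC; apply: le_trans (CcP _ (p01 c)) _.
  rewrite lerD2l ler_wpM2r// (bigD1 c)//= lerDl.
  by apply: sumr_ge0 => c' _; case: (CP c').
rewrite big_split /=; apply: lerD; last by rewrite mulr_sumr.
rewrite sumr_const -[X in X <= _]mulr_natl /e1 mulrCA.
by rewrite ler_piMr ?(ltW eps0)// ler_pdivrMr// mul1r ler_nat.
Qed.

End EntropyModulus.

Section LocalApproximation.
Context (R : realType) (V : finType) (e : rel V) (o : V).
Local Notation T := (ucover e o).
Context (A B : alphabetType) (nu : probability (config T A) R).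
Context (tau : config T A -> config T B).
Hypothesis tau_meas : measurable_fun [set: config T A] tau.
Hypothesis tau_equiv : equivariant tau.

Definition deck_shift (A' : alphabetType) (g : deck e o) (w : config T A') : config T A' :=
  fun p => w (g p).

Lemma tau_deck_shift g w p : tau (deck_shift g w) p = tau w (g p).
Proof.
have ->: w = Defs.act g (deck_shift g w).
  by apply/funext => q; rewrite /Defs.act /deck_shift deck_invK.
by rewrite tau_equiv /Defs.act deck_funK; congr (tau _ p); apply/funext => q;
  rewrite /deck_shift deck_funK.
Qed.

Lemma finite_pickle k : finite_set [set p : T | (choice.pickle p < k)%N].
Proof.
apply: (@sub_finite_set _ _ ((odflt (uroot e o) \o (@choice.unpickle T)) @` `I_k)).
  by move=> p /= pk; exists (choice.pickle p) => //=; rewrite choice.pickleK.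
exact/finite_image/finite_II.
Qed.

Lemma measurable_deck_shift g : measurable_fun setT (@deck_shift A g).
Proof.
apply: (@measurability _ _ _ _ setT (@deck_shift A g)
  (@open (prod_topology (fun _ : T => discrete_topology A)))) => //.
move=> _ [] O oO <-; rewrite setTI.
have -> : @deck_shift A g @^-1` O = \bigcup_k [set w | agree k (deck_shift g w) `<=` O].
  rewrite predeqE => w; split => [Ow|[k _]]; last by apply.
  by have [k kO] := open_prefix oO Ow; exists k.
apply: bigcupT_measurable => k.
have [k' dk'] : exists k', determined k' [set w : config T A | agree k (deck_shift g w)
  `<=` O].
  apply: (@finite_determined _ _ (g @` [set p : T | (choice.pickle p < k)%N])).
    exact/finite_image/finite_pickle.
  move=> w w' ww' /= wO v w'v; apply: wO => t tk; rewrite /deck_shift ww'; last by exists t.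
  exact: w'v.
exact: determined_measurable dk'.
Qed.

(** The letter of [tau w] at [v i] is guessed from finitely many coordinates
   by approximating the events that it takes a given value. By equivariance the
   same guess, applied after a deck transformation, predicts the letters at the
   translates of [v i]; the approximation therefore has to hold simultaneously
   for the images of [nu] under these transformations. *)
Lemma local_approximation (I J : finType) (g : J -> deck e o) (v : I -> T) (eps : R) :
  0 < eps -> exists k (f : I -> config T A -> B),
  (forall i w w', agree k w w' -> f i w = f i w') /\
  forall i j, exists Bad, [/\ measurable Bad, (nu Bad <= eps%:E)%E &
    forall w, ~ Bad w -> f i (deck_shift (g j) w) = tau w (g j (v i))].
Proof.
move=> eps0; pose e1 := eps / (#|B|.+1)%:R.
have e10 : 0 < e1 by rewrite divr_gt0.
have /choice[P PE] : forall j, exists P : probability (config T A) R,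
    forall X, P X = nu (deck_shift (g j) @^-1` X).
  by move=> j; apply: pushforward_probability; exact: measurable_deck_shift.
pose X (ib : I * B) : set (config T A) := [set w | tau w (v ib.1) = ib.2].
have mX ib : measurable (X ib).
  rewrite -[X ib]setTI.
  exact: (tau_meas measurableT (measurable_coord (v ib.1) ib.2)).
have /choice[C CP] : forall ib, exists C, exists k,
    determined k C /\ forall j, (P j (symdiff (X ib) C) < e1%:E)%E.
  move=> ib; have [_ /(_ _ e10)[k [C CP]]] := measurable_approximable P (mX ib).
  by exists C, k.
have /choice[kk kkP] := CP.
pose k := (\max_ib kk ib)%N.
have dC ib : determined k (C ib).
  have [d _] := kkP ib; apply: determined_le d; exact: leq_bigmax.
have mC ib : measurable (C ib : set (config T A)) by exact: determined_measurable (dC ib).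
pose f i (w : config T A) := odflt point [pick b | `[< C (i, b) w >]].
exists k, f; split=> [i w w' ww'|i j].
  rewrite /f; congr odflt; apply: eq_pick => b; apply: asbool_equiv_eq.
  by split; apply: dC => // t tk; rewrite ww'.
pose Bad0 := \big[setU/set0]_(b : B) symdiff (X (i, b)) (C (i, b)).
have mS b : measurable (symdiff (X (i, b)) (C (i, b))) by exact: measurable_symdiff.
have mBad0 : measurable Bad0 by apply: bigsetU_measurable.
exists (deck_shift (g j) @^-1` Bad0); split.
- rewrite -[X in measurable X]setTI; exact: measurable_deck_shift.
- rewrite -PE.
  have bound (s : seq B) : (P j (\big[setU/set0]_(b <- s) symdiff (X (i, b)) (C (i, b))) <=
      (e1 *+ size s)%:E)%E.
    elim: s => [|b s IH]; first by rewrite big_nil measure0.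
    rewrite big_cons mulrS EFinD.
    have mU : measurable (\big[setU/set0]_(b <- s) symdiff (X (i, b)) (C (i, b))).
      exact: bigsetU_measurable.
    apply: le_trans (measureU2 _ (mS b) mU) _.
    by apply: leeD; [apply: ltW; case: (kkP (i, b)) => _; apply|exact: IH].
  apply: le_trans (bound _) _; rewrite lee_fin -mulr_natl /e1 mulrCA.
  have -> : size (index_enum B) = #|B| by rewrite cardE enumT.
  by rewrite ler_piMr ?(ltW eps0)// ler_pdivrMr// mul1r ler_nat.
move=> w nBad; have good b : C (i, b) (deck_shift (g j) w) <-> X (i,
  b) (deck_shift (g j) w).
  have nb : ~ symdiff (X (i, b)) (C (i, b)) (deck_shift (g j) w).
    move=> Sb; apply: nBad; rewrite /preimage /Bad0 /= (bigD1 b)//=; by left.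
  split=> [Cw|Xw]; apply: contrapT => h; apply: nb; first by right.
  by left.
rewrite -tau_deck_shift /f; case: pickP => [b /asboolP/good Xb|none]; first exact/esym/Xb.
by have /negP[] := none (tau (deck_shift (g j) w) (v i)); apply/asboolP/good.
Qed.

End LocalApproximation.

(** * Labelling the glued copies *)

Lemma sum_pair (R : realType) (S S' : finType) (h : S * S' -> R) :
  \sum_p h p = \sum_a \sum_b h (a, b).
Proof. by rewrite pair_bigA; apply: eq_bigr => -[]. Qed.

Section LiftModel.
Context (R : realType) (V : finType) (e : rel V) (o : V).
Hypothesis e_sym : symmetric e.
Local Notation T := (ucover e o).
Local Notation adj := (@uadj V e o).
Context (A B : alphabetType) (D : nat) (psi : potential R adj A D).
Hypothesis psi_inv : invariant_potential psi.
Context (vlift : V -> T) (vliftP : forall v, uproj (vlift v) = v).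
Context (Ed : finType) (u1 u2 : Ed -> T).
Hypothesis u12 : forall E, uadj (u1 E) (u2 E).
Local Notation s E := (uproj (u1 E)).
Local Notation t E := (uproj (u2 E)).
Hypothesis st_inj : injective (fun E => (s E, t E)).
Hypothesis st_asym : forall E E', (s E, t E) <> (t E', s E').
Context (g1 g2 : Ed -> deck e o).
Hypothesis g1P : forall E, g1 E (vlift (s E)) = u1 E.
Hypothesis g2P : forall E, g2 E (vlift (t E)) = u2 E.
Context (K : finType) (kap : V -> V -> K -> K).
Hypothesis kapK : forall u v, e u v -> cancel (kap u v) (kap v u).
Context (n : nat).
Local Notation X := (K * 'I_n)%type.
Context (sigma : {ffun Ed * K -> {perm 'I_n}}).

(** The gluing of [n] copies of the covering [kap], where [sigma] prescribes
   how the copies are permuted along the oriented edges. The permutation is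
   inverted when the edge is traversed backwards; the last branch concerns pairs
   that are not joined by an edge of [Ed]. *)
Definition glue_step (u v : V) (ai : X) : X :=
  let a' := kap u v ai.1 in
  (a', if [pick E | (s E, t E) == (u, v)] is Some E then sigma (E, ai.1) ai.2
       else if [pick E | (s E, t E) == (v, u)] is Some E then (sigma (E, a'))^-1%g ai.2
       else ai.2).

Lemma glue_step_edge E ai :
  glue_step (s E) (t E) ai = (kap (s E) (t E) ai.1, sigma (E, ai.1) ai.2).
Proof.
rewrite /glue_step; case: pickP => [E' /eqP/st_inj -> //|/(_ E)].
by rewrite eqxx.
Qed.

Lemma glue_stepK u v : e u v -> cancel (glue_step u v) (glue_step v u).
Proof.
move=> uv [a i]; rewrite /glue_step /= kapK//; congr (_, _).
have [E /eqP Euv|none1] := pickP (fun E => (s E, t E) == (u, v)).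
  case: pickP => [E' /eqP E'vu|_].
    by case: (@st_asym E E'); move: Euv E'vu => [-> ->] [-> ->].
  by rewrite permK.
have [E /eqP Evu|none2] := pickP (fun E => (s E, t E) == (v, u)).
  by rewrite permKV.
by [].
Qed.

Local Notation st := glue_step.
Local Notation stK := glue_stepK.

(** The first coordinate forgets the gluing, which is why the injectivity
   radius of the glued graph is at least that of [kap]. *)
Lemma trace_glue a i (p : T) : (trace st (a, i) p).1 = trace kap a p.
Proof.
elim/ucover_ind: p => [|p x px IH] //.
by rewrite !trace_ustep//=; [rewrite IH|exact: glue_stepK].
Qed.

Definition lift_start (p : T) (ai : X) : X := invF (trace_inj stK (p := p)) ai.

Lemma lift_startP p ai : trace st (lift_start p ai) p = ai.
Proof. exact: (f_invF (trace_inj stK (p := p)) ai). Qed.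

Lemma lift_start_inj p : injective (lift_start p).
Proof. by move=> ai ai' E; rewrite -(lift_startP p ai) E lift_startP. Qed.

Implicit Types x : {ffun V * X -> A}.
Local Notation pullst j x := (pull st j x : T -> A).

(** The configuration seen from the lift that puts [p] at [ai] is a deck
   translate of the one seen from any other lift that passes there. *)
Lemma pull_deck (g : deck e o) m p ai x : trace st m (g p) = ai ->
  pullst (lift_start p ai) x = deck_shift g (pullst m x).
Proof.
move=> mg; apply/funext => q; rewrite /pull /deck_shift (cover_map_deck e_sym stK).
congr (x (cover_map st _ _)); apply: (trace_inj stK (p := p)).
by rewrite /= lift_startP -(trace_deck e_sym stK).
Qed.

Context (f : V -> config T A -> B).

Definition labels x : {ffun V * K -> {ffun 'I_n -> B}} :=
  [ffun va => [ffun i => f va.1 (pullst (lift_start (vlift va.1) (va.2, i)) x)]].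

Definition edge_tail (Ea : Ed * K) : V * K := (s Ea.1, Ea.2).
Definition edge_head (Ea : Ed * K) : V * K := (t Ea.1, kap (s Ea.1) (t Ea.1) Ea.2).

Definition vertex_event (vb : V * B) : set (T -> A) := [set w | f vb.1 w = vb.2].
(** Both letters of an edge are read from a single copy of the tree, in which
   the edge lies at [(u1 E, u2 E)]; the deck transformations [g1] and [g2] bring
   the distinguished vertices [vlift] of the fibres to its ends. *)
Definition edge_event (Ebc : Ed * (B * B)) : set (T -> A) :=
  [set w | f (s Ebc.1) (deck_shift (g1 Ebc.1) w) = Ebc.2.1 /\
           f (t Ebc.1) (deck_shift (g2 Ebc.1) w) = Ebc.2.2].

(** The [n] starting points that put the distinguished vertex, or the source
   of the distinguished edge, at the copies of a given vertex of the
   covering. *)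
Definition block (la : (V + Ed) * K) (i : 'I_n) : X :=
  lift_start (match la.1 with inl v => vlift v | inr E => u1 E end) (la.2, i).

Lemma block_inj la : injective (block la).
Proof. by move=> i i' /lift_start_inj []. Qed.

Lemma freq_emp (Q : finType) (z : {ffun 'I_n -> Q}) (q : Q) C (b : 'I_n -> X) x :
  (forall i, C (pullst (b i) x) <-> z i = q) -> freq R z q = empirical R st C b x.
Proof.
move=> Cz; rewrite /freq /empirical /occ; congr (_ / _).
rewrite -sum1_card natr_sum big_mkcond /=; apply: eq_bigr => i _.
rewrite inE /ind; case: eqP => [/Cz/asboolP -> //|ni].
by have /asboolPn/negPf -> : ~ C (pullst (b i) x) by move=> /Cz.
Qed.

Lemma freq_vertex x v a b :
  freq R (labels x (v, a)) b = empirical R st (vertex_event (v, b)) (block (inl v, a)) x.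
Proof. by apply: freq_emp => i; rewrite !ffunE. Qed.

Lemma freq_edge x E a bc :
  freq R (edge_pairing edge_tail edge_head sigma (labels x) (E, a)) bc =
  empirical R st (edge_event (E, bc)) (block (inr E, a)) x.
Proof.
apply: freq_emp => i; rewrite /edge_event /edge_pairing !ffunE /block /=.
set m := lift_start (u1 E) (a, i).
have m1 : trace st m (g1 E (vlift (s E))) = (a, i) by rewrite g1P lift_startP.
have m2 : trace st m (g2 E (vlift (t E))) = (kap (s E) (t E) a, sigma (E, a) i).
  rewrite g2P; have [su u2E] := uadjP e_sym (u12 E).
  by rewrite {1}u2E (trace_ustep stK)// lift_startP glue_step_edge.
rewrite (pull_deck _ m1) (pull_deck _ m2).
by case: bc => b c /=; split=> [[-> ->]|[-> ->]].
Qed.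

Context (F : {fset T}) (r : nat).
Hypothesis FL : {subset F <= root_ball e o r}.
Hypothesis kap_inj : forall a (p q : T), (size (val p) <= r + 2 * D)%N ->
  (size (val q) <= r + 2 * D)%N -> trace kap a p = trace kap a q -> p = q.
Context (cv : V * B -> R) (ce : Ed * (B * B) -> R) (delta eta : R).
Hypothesis dv : forall vb, depends F (vertex_event vb).
Hypothesis de : forall Ebc, depends F (edge_event Ebc).
Hypothesis cv01 : forall vb, 0 <= cv vb <= 1.
Hypothesis ce01 : forall Ebc, 0 <= ce Ebc <= 1.
Hypothesis delta_ge0 : 0 <= delta.
Hypothesis unif_v : forall vb w,
  `|gibbs_kernel psi (root_ball e o r) w (vertex_event vb) - cv vb| <= delta.
Hypothesis unif_e : forall Ebc w,
  `|gibbs_kernel psi (root_ball e o r) w (edge_event Ebc) - ce Ebc| <= delta.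
Hypothesis n_gt0 : (0 < n)%N.
Hypothesis eta_gt0 : 0 < eta.
Hypothesis small : delta + (#|` F| * #|` root_ball e o r|)%:R / n%:R <= eta ^+ 2.

(** The local rule is applied to the configuration provided by [good_config],
   whose frequencies count the vertex and edge events. *)
Lemma good_labelling : exists y : {ffun V * K -> {ffun 'I_n -> B}},
  \sum_va \sum_b `|freq R (y va) b - cv (va.1, b)| +
  \sum_Ea \sum_bc `|freq R (edge_pairing edge_tail edge_head sigma y Ea) bc - ce (Ea.1, bc)|
  <= (#|{: (V + Ed) * K}| * #|{: V * B + Ed * (B * B)}|)%:R * eta.
Proof.
pose C (l : V * B + Ed * (B * B)) : set (T -> A) :=
  match l with inl vb => vertex_event vb | inr Ebc => edge_event Ebc end.
pose c (l : V * B + Ed * (B * B)) : R :=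
  match l with inl vb => cv vb | inr Ebc => ce Ebc end.
have inj j : {in nbh adj (2 * D) [set` root_ball e o r] &, injective (cover_map st j)}.
  case: j => a i p q /set_mem/nbh_root_ball pr /set_mem/nbh_root_ball qr [_ pq].
  by apply: (@kap_inj a) => //; rewrite -!(trace_glue _ i) pq.
have [x xP] : exists x, \sum_(la : (V + Ed) * K) \sum_(l : V * B + Ed * (B * B))
    `|empirical R st (C l) (block la) x - c l| <=
    (#|{: (V + Ed) * K}| * #|{: V * B + Ed * (B * B)}|)%:R * eta.
  apply: (@good_config R V e o e_sym A D psi psi_inv vlift vliftP X st stK
    (root_ball e o r) F FL inj _ _ C c delta eta n block) => //.
  - by case.
  - by case.
  - by case.
  - exact: block_inj.
exists (labels x); apply: le_trans xP.
rewrite [leRHS]sum_pair big_sumType /=.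
apply: lerD; rewrite sum_pair; apply: ler_sum => v _; apply: ler_sum => a _;
  rewrite big_sumType /=.
  apply: ler_wpDr; first by rewrite sumr_ge0.
  rewrite [leRHS]sum_pair (bigD1 v)//=; apply: ler_wpDr.
    by rewrite sumr_ge0// => v' _; rewrite sumr_ge0.
  by apply: ler_sum => b _; rewrite freq_vertex.
apply: ler_wpDl; first by rewrite sumr_ge0.
rewrite [leRHS]sum_pair (bigD1 v)//=; apply: ler_wpDr.
  by rewrite sumr_ge0// => v' _; rewrite sumr_ge0.
by apply: ler_sum => bc _; rewrite freq_edge.
Qed.

End LiftModel.

(** * The entropy inequality *)

Section Auxiliary.
Context (R : realType).

Lemma large_sample (M1 M2 d1 d2 : R) : 0 <= M1 -> 0 <= M2 -> 0 < d1 -> 0 < d2 ->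
  exists n, [/\ (0 < n)%N, M1 / n%:R <= d1 & M2 * (1 + ln n.+1%:R) <= n%:R * d2].
Proof.
move=> M10 M20 d10 d20.
have p1 : 0 <= M1 / d1 by rewrite divr_ge0// ltW.
have p2 : 0 <= 3 * M2 / d2 by rewrite divr_ge0 ?mulr_ge0// ltW.
have [N NP] : exists N, M1 / d1 + 3 * M2 / d2 <= N.+1%:R.
  exists (Num.bound (M1 / d1 + 3 * M2 / d2)).
  have /ltW h := archi_boundP (addr_ge0 p1 p2).
  by apply: le_trans h _; rewrite ler_nat.
set m : R := N.+1%:R in NP; have m1 : 1 <= m by rewrite ler1n.
have m0 : 0 < m by rewrite ltr0n.
have q1 : M1 <= m * d1 by rewrite -ler_pdivrMr//; lra.
have q2 : 3 * M2 <= m * d2 by rewrite -ler_pdivrMr//; lra.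
(* A square is chosen because ln ((N + 1) ^ 2) grows at most linearly in N. *)
exists (N.+1 ^ 2)%N; split; first by rewrite expn_gt0.
  rewrite natrX ler_pdivrMr ?exprn_gt0// -/m expr2 mulrA [d1 * m]mulrC.
  by apply: le_trans q1 _; rewrite ler_peMr// mulr_ge0// ltW.
have lnb : 1 + ln ((N.+1 ^ 2).+1%:R) <= 3 * m.
  have : ln ((N.+1 ^ 2).+1%:R) <= ln ((m + 1) ^+ 2).
    rewrite ler_ln ?posrE ?ltr0n ?exprn_gt0 ?addr_gt0// -natr1 natrX -/m.
    by rewrite sqrrD expr1n lerD2r mulr1 lerDl mulrn_wge0// ltW.
  rewrite lnXn ?addr_gt0// => h.
  have := ln_le_sub1 (_ : 0 < m + 1); rewrite addr_gt0// => /(_ isT).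
  lra.
apply: (@le_trans _ _ (M2 * (3 * m))); first by rewrite ler_wpM2l.
rewrite natrX -/m mulrCA expr2 -mulrA; have := ler_wpM2r (ltW m0) q2; lra.
Qed.

Lemma close_measure d (S : measurableType d) (P : probability S R)
    (Y Y' Bad : set S) (eps : R) :
  measurable Y -> measurable Y' -> measurable Bad -> (P Bad <= eps%:E)%E ->
  (forall w, ~ Bad w -> Y w <-> Y' w) -> `|fine (P Y) - fine (P Y')| <= eps.
Proof.
move=> mY mY' mB PB YY'.
have half Y1 Y2 : measurable Y1 -> measurable Y2 -> (forall w, ~ Bad w -> Y1 w -> Y2 w) ->
    fine (P Y1) <= fine (P Y2) + eps.
  move=> m1 m2 h; rewrite -lee_fin EFinD !fineK ?fin_num_measure//.
  apply: (@le_trans _ _ (P (Y2 `|` Bad))).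
    apply: le_measure; rewrite ?inE//; first exact: measurableU.
    by move=> w Y1w; have [Bw|nB] := pselect (Bad w); [right|left; apply: h].
  apply: le_trans (measureU2 _ m2 mB) _; exact: leeD2l.
have h1 := half _ _ mY mY' (fun w nB => (YY' w nB).1).
have h2 := half _ _ mY' mY (fun w nB => (YY' w nB).2).
by rewrite ler_norml; apply/andP; split; lra.
Qed.

Lemma prob01 d (S : measurableType d) (P : probability S R) (Y : set S) :
  measurable Y -> 0 <= fine (P Y) <= 1.
Proof.
move=> mY; rewrite fine_ge0//= -lee_fin fineK ?fin_num_measure//.
exact: probability_le1.
Qed.

Lemma freq01 (n : nat) (Q : finType) (z : {ffun 'I_n -> Q}) (q : Q) : 0 <= freq R z q <= 1.
Proof.
rewrite /freq divr_ge0//=; have [n0|n0] := posnP n.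
  by rewrite (_ : n%:R = 0) ?invr0 ?mulr0// n0.
rewrite ler_pdivrMr ?ltr0n// mul1r ler_nat; exact: occ_le.
Qed.

(** The frequencies [p] are compared with the target laws [q] through the
   probabilities [r] of the local approximations. *)
Lemma entropies_close (I Q : finType) (p q r : I -> Q -> R) (C eps eps0 : R) :
  0 <= C -> (forall i, `|entropy (p i) - entropy (q i)| <=
    eps + C * \sum_c `|p i c - q i c|) ->
  (forall i c, `|r i c - q i c| <= eps0) ->
  \sum_i `|entropy (p i) - entropy (q i)| <=
  #|I|%:R * eps + C * (\sum_i \sum_c `|p i c - r i c| + (#|I| * #|Q|)%:R * eps0).
Proof.
move=> C0 pq rq; apply: (@le_trans _ _ (\sum_(i : I) (eps + C * (\sum_c `|p i c - r i c| +
    #|Q|%:R * eps0)))).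
  apply: ler_sum => i _; apply: le_trans (pq i) _; rewrite lerD2l ler_wpM2l//.
  apply: (@le_trans _ _ (\sum_c (`|p i c - r i c| + eps0))).
    apply: ler_sum => c _; apply: le_trans (ler_distD (r i c) _ _) _.
    by rewrite lerD2l.
  by rewrite big_split/= sumr_const mulr_natl.
rewrite big_split /= sumr_const -mulr_sumr big_split /= sumr_const.
by rewrite -[eps *+ _]mulr_natl -[(_ * eps0) *+ _]mulr_natl mulrA -natrM.
Qed.

End Auxiliary.

Section Core.
Context (R : realType) (V : finType) (e : rel V) (o : V).
Hypothesis e_sym : symmetric e.
Hypothesis e_irr : irreflexive e.
Local Notation T := (ucover e o).
Local Notation adj := (@uadj V e o).
Context (A B : alphabetType) (D : nat) (psi : potential R adj A D).
Hypothesis psi_inv : invariant_potential psi.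
Context (nu : probability (config T A) R) (nu_gibbs : is_unique_gibbs psi nu).
Context (tau : config T A -> config T B).
Hypothesis tau_meas : measurable_fun [set: config T A] tau.
Hypothesis tau_equiv : equivariant tau.
Context (vlift : V -> T) (vliftP : forall v, uproj (vlift v) = v).
Context (Ed : finType) (u1 u2 : Ed -> T).
Hypothesis u12 : forall E, uadj (u1 E) (u2 E).
Local Notation s E := (uproj (u1 E)).
Local Notation t E := (uproj (u2 E)).
Hypothesis st_inj : injective (fun E => (s E, t E)).
Hypothesis st_asym : forall E E', (s E, t E) <> (t E', s E').

Let mu := pushforward nu tau.
Local Notation Hv v := (entropy (vertex_law mu (vlift v))).
Local Notation He E := (entropy (edge_law mu (u1 E) (u2 E))).

Definition deck_id : deck e o :=
  @Deck V e o id id (fun=> erefl) (fun=> erefl) (fun _ _ => erefl) (fun=> erefl).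

Lemma measurable_tau (p : T) (b : B) : measurable [set w | tau w p = b].
Proof.
rewrite -[X in measurable X]setTI; exact: (tau_meas measurableT (measurable_coord p b)).
Qed.

Lemma measurable_tau2 (p q : T) (c : B * B) :
  measurable [set w | tau w p = c.1 /\ tau w q = c.2].
Proof. by apply: measurableI; exact: measurable_tau. Qed.

(** The map [tau] is replaced by local rules [f], at the cost of [eps] in the
   probabilities of the letters at vertices and of the pairs of letters at
   edges. *)
Lemma local_events (eps : R) : 0 < eps ->
  exists (f : V -> config T A -> B) (g1 g2 : Ed -> deck e o) (F : {fset T}),
  [/\ forall E, g1 E (vlift (s E)) = u1 E /\ g2 E (vlift (t E)) = u2 E,
      forall vb, depends F (vertex_event f vb),
      forall Ebc, depends F (edge_event u1 u2 g1 g2 f Ebc),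
      forall v b, `|fine (nu (vertex_event f (v, b))) -
                    vertex_law mu (vlift v) b| <= eps &
      forall E bc, `|fine (nu (edge_event u1 u2 g1 g2 f (E, bc))) -
                    edge_law mu (u1 E) (u2 E) bc| <= eps].
Proof.
move=> eps0; have e2 : 0 < eps / 2 by lra.
have /choice[g1 g1P] : forall E, exists g : deck e o, g (vlift (s E)) = u1 E.
  by move=> E; apply: deck_trans => //; rewrite vliftP.
have /choice[g2 g2P] : forall E, exists g : deck e o, g (vlift (t E)) = u2 E.
  by move=> E; apply: deck_trans => //; rewrite vliftP.
pose g (j : option (Ed + Ed)) : deck e o :=
  match j with None => deck_id | Some (inl E) => g1 E | Some (inr E) => g2 E end.
have [k [f [fk fP]]] := @local_approximation R V e o A B nu tau tau_meas tau_equiv V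
  (option (Ed + Ed)) g vlift (eps / 2) e2.
pose F0 := \bigcup_(j : option (Ed + Ed)) (g j @` [set p : T | (choice.pickle p < k)%N]).
have fF0 : finite_set F0.
  apply: bigcup_finite => [|j _]; first exact: finite_finset.
  exact/finite_image/finite_pickle.
have inF j p : (choice.pickle p < k)%N -> g j p \in fset_set F0.
  by move=> pk; rewrite in_fset_set//; apply/mem_set; exists j => //; exists p.
have dv vb : depends (fset_set F0) (vertex_event f vb).
  move=> w w' ww'; rewrite /vertex_event /= => <-.
  apply/esym/fk => p pk; apply: ww'.
  exact: (inF None).
have de Ebc : depends (fset_set F0) (edge_event u1 u2 g1 g2 f Ebc).
  move=> w w' ww'; rewrite /edge_event /= => -[<- <-].
  split; apply/esym/fk => p pk; rewrite /deck_shift; apply: ww'.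
    exact: (inF (Some (inl Ebc.1))).
  exact: (inF (Some (inr Ebc.1))).
have mdep C : depends (fset_set F0) C -> measurable (C : set (config T A)).
  move=> dC; have [k' dk'] : exists k', determined k' C.
    apply: (finite_determined fF0) => w w' ww'; apply: dC => p.
    by rewrite in_fset_set// => /set_mem; exact: ww'.
  exact: determined_measurable dk'.
exists f, g1, g2, (fset_set F0); split=> // [v b|E bc].
  have [Bad [mBad nuBad good]] := fP v None.
  apply: (@close_measure _ _ _ _ _ _ Bad) => //.
  - exact: (mdep _ (dv (v, b))).
  - exact: measurable_tau.
  - by apply: le_trans nuBad _; rewrite lee_fin; lra.
  - by move=> w /good fw; rewrite /vertex_event /preimage /= -fw.
have [Bad1 [mBad1 nuBad1 good1]] := fP (s E) (Some (inl E)).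
have [Bad2 [mBad2 nuBad2 good2]] := fP (t E) (Some (inr E)).
apply: (@close_measure _ _ _ _ _ _ (Bad1 `|` Bad2)) => //.
- exact: (mdep _ (de (E, bc))).
- exact: measurable_tau2.
- exact: measurableU.
- apply: le_trans (measureU2 _ mBad1 mBad2) _.
  have -> : (eps%:E = (eps / 2)%:E + (eps / 2)%:E)%E by rewrite -EFinD -splitr.
  exact: leeD.
- move=> w nB; have n1 : ~ Bad1 w by move=> ?; apply: nB; left.
  have n2 : ~ Bad2 w by move=> ?; apply: nB; right.
  have := good1 w n1; rewrite /g g1P => h1; have := good2 w n2; rewrite /g g2P => h2.
  by rewrite /edge_event /preimage /= h1 h2.
Qed.

(** The covering is [voltage], with a radius for which the Gibbs kernel is
   uniformly close to [nu] on the vertex and edge events. All its gluings have a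
   labelling with nearly the right frequencies, and [lift_counting] selects one
   that satisfies the entropy inequality. *)
Lemma finite_model (f : V -> config T A -> B) (g1 g2 : Ed -> deck e o)
    (F : {fset T}) (eta d : R) :
  (forall E, g1 E (vlift (s E)) = u1 E /\ g2 E (vlift (t E)) = u2 E) ->
  (forall vb, depends F (vertex_event f vb)) ->
  (forall Ebc, depends F (edge_event u1 u2 g1 g2 f Ebc)) ->
  0 < eta -> 0 < d ->
  exists (K : finType) (kap : V -> V -> K -> K) (n : nat)
    (sigma : {ffun Ed * K -> {perm 'I_n}}) (y : {ffun V * K -> {ffun 'I_n -> B}}),
  let tl := edge_tail u1 (K := K) in let hd := edge_head u1 u2 kap in
  let ep := edge_pairing tl hd sigma y in
  [/\ (0 < #|K|)%N, (0 < n)%N, forall E, injective (kap (s E) (t E)),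
    \sum_va \sum_b `|freq R (y va) b - fine (nu (vertex_event f (va.1, b)))| +
    \sum_Ea \sum_bc `|freq R (ep Ea) bc - fine (nu (edge_event u1 u2 g1 g2 f (Ea.1, bc)))|
    <= (#|{: (V + Ed) * K}| * #|{: V * B + Ed * (B * B)}|)%:R * eta &
    0 <= \sum_va entropy (freq R (y va)) +
      \sum_Ea (entropy (freq R (ep Ea)) - entropy (freq R (y (tl Ea))) -
               entropy (freq R (y (hd Ea)))) + d].
Proof.
move=> g12 dv de eta0 d0.
have det (C : set (T -> A)) : depends F C -> exists k, determined k C.
  move=> dC; apply: (@finite_determined _ _ [set` F]); first exact: finite_fset.
  by move=> w w' ww'; apply: dC => p pF; exact: ww'.
have delta0 : 0 < eta ^+ 2 / 2 by rewrite divr_gt0 ?exprn_gt0.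
have unif := unique_uniform (@uadj_sym V e o) (@uBall_fin V e o) (@root_ball_exhaust V e
  o) nu_gibbs.
have near_v : \forall r \near \oo, forall vb w,
    `|gibbs_kernel psi (root_ball e o r) w (vertex_event f vb) - fine (nu (vertex_event f
      vb))| <= eta ^+ 2 / 2.
  apply: filter_forall => vb; have [k dk] := det _ (dv vb).
  exact: unif _ _ dk _ delta0.
have near_e : \forall r \near \oo, forall Ebc w,
    `|gibbs_kernel psi (root_ball e o r) w (edge_event u1 u2 g1 g2 f Ebc) -
      fine (nu (edge_event u1 u2 g1 g2 f Ebc))| <= eta ^+ 2 / 2.
  apply: filter_forall => Ebc; have [k dk] := det _ (de Ebc).
  exact: unif _ _ dk _ delta0.
have near_F := root_ball_exhaust_fset (@root_ball_exhaust V e o) F.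
have [r [unif_v [unif_e FL]]] : exists r,
  (forall vb w, `|gibbs_kernel psi (root_ball e o r) w (vertex_event f vb) -
      fine (nu (vertex_event f vb))| <= eta ^+ 2 / 2) /\
  (forall Ebc w, `|gibbs_kernel psi (root_ball e o r) w (edge_event u1 u2 g1 g2 f Ebc) -
      fine (nu (edge_event u1 u2 g1 g2 f Ebc))| <= eta ^+ 2 / 2) /\
  {subset F <= root_ball e o r}.
  have [N1 _ h1] := near_v; have [N2 _ h2] := near_e; have [N3 _ h3] := near_F.
  exists (maxn N1 (maxn N2 N3)); split; [|split].
  - by apply: h1; rewrite /= leq_maxl.
  - by apply: h2; rewrite /= !leq_max leqnn orbT.
  - by apply: h3; rewrite /= !leq_max leqnn !orbT.
pose K : finType := {perm (r + 2 * D).-bseq V}.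
pose kap : V -> V -> K -> K := @voltage V e o e_sym e_irr (r + 2 * D).
have kapK u v : e u v -> cancel (kap u v) (kap v u) by exact: voltageK.
pose M1 : R := (#|` F| * #|` root_ball e o r|)%:R.
pose M2 : R := poly_degree R (V * K)%type (Ed * K)%type B.
have [//|//|n [n0 nM1 nM2]] := @large_sample R M1 M2 (eta ^+ 2 / 2) d _ _ delta0 d0.
have small : eta ^+ 2 / 2 + M1 / n%:R <= eta ^+ 2 by lra.
have mdep (C : set (T -> A)) : depends F C -> measurable (C : set (config T A)).
  by move=> /det[k' dk']; exact: determined_measurable dk'.
have exists_y (sigma : {ffun Ed * K -> {perm 'I_n}}) :=
  @good_labelling R V e o e_sym A B D psi psi_inv vlift vliftP Ed u1 u2 u12 st_inj
    st_asym g1 g2 (fun E => (g12 E).1) (fun E => (g12 E).2) K kap kapK n sigma f F r FL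
    (fun a p q => @voltage_inj V e o e_sym e_irr (r + 2 * D) a p q)
    (fun vb => fine (nu (vertex_event f vb)))
    (fun Ebc => fine (nu (edge_event u1 u2 g1 g2 f Ebc)))
    (eta ^+ 2 / 2) eta dv de
    (fun vb => prob01 nu (mdep _ (dv vb))) (fun Ebc => prob01 nu (mdep _ (de Ebc)))
    (ltW delta0) unif_v unif_e n0 eta0 small.
have [sigma [y [good count]]] := @lift_counting R (V * K)%type (Ed * K)%type B
  (edge_tail u1 (K := K)) (edge_head u1 u2 kap) n n0 _ exists_y.
exists K, kap, n, sigma, y; split=> //.
- by apply/card_gt0P; exists 1%g.
- move=> E; have [st _] := uadjP e_sym (u12 E); exact: (can_inj (kapK _ _ st)).
- have n0R : (0 : R) < n%:R by rewrite ltr0n.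
  rewrite -(pmulr_rge0 _ n0R) mulrDr; apply: le_trans count _.
  by rewrite lerD2l.
Qed.

(** The inequality of [finite_model] for empirical laws passes to the limit:
   the frequencies tend to the marginals, and each of the [#|K|] points above a
   vertex or an edge contributes the same limit. *)
Lemma oriented_entropy_inequality :
  0 <= \sum_v Hv v + \sum_E (He E - Hv (s E) - Hv (t E)).
Proof.
set X := (X in 0 <= X).
have lawv v c : 0 <= vertex_law mu (vlift v) c <= 1
  by exact: (prob01 nu (measurable_tau (vlift v) c)).
have lawe E c : 0 <= edge_law mu (u1 E) (u2 E) c <= 1
  by exact: (prob01 nu (measurable_tau2 (u1 E) (u2 E) c)).
pose c0 : R := (1 + 2 * #|Ed|%:R) * (#|V|%:R + #|Ed|%:R + 2) + 1.
have c0_gt0 : 0 < c0 by rewrite ltr_wpDl// mulr_ge0// !addr_ge0// mulr_ge0.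
suff key eps : 0 < eps -> 0 <= X + c0 * eps.
  apply/ler_addgt0Pr => eps eps0; have := key (eps / c0) (divr_gt0 eps0 c0_gt0).
  by rewrite mulrCA divff ?gt_eqF// mulr1.
move=> eps0.
have /choice[Cv CvP] : forall v, exists C, 0 <= C /\ forall p : B -> R,
    (forall c, 0 <= p c <= 1) -> `|entropy p - Hv v| <=
    eps + C * \sum_c `|p c - vertex_law mu (vlift v) c|.
  by move=> v; have [C C0 CP] := entropy_modulus (lawv v) eps0; exists C.
have /choice[Ce CeP] : forall E, exists C, 0 <= C /\ forall p : B * B -> R,
    (forall c, 0 <= p c <= 1) -> `|entropy p - He E| <=
    eps + C * \sum_c `|p c - edge_law mu (u1 E) (u2 E) c|.
  by move=> E; have [C C0 CP] := entropy_modulus (lawe E) eps0; exists C.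
pose C := \sum_v Cv v + \sum_E Ce E.
have sv0 : 0 <= \sum_v Cv v by apply: sumr_ge0 => v _; case: (CvP v).
have se0 : 0 <= \sum_E Ce E by apply: sumr_ge0 => v _; case: (CeP v).
have C0 : 0 <= C by rewrite addr_ge0.
have CvC v : Cv v <= C.
  rewrite /C (bigD1 v)//= -addrA lerDl addr_ge0// sumr_ge0// => v' _.
  by case: (CvP v').
have CeC E : Ce E <= C.
  rewrite /C addrC (bigD1 E)//= -addrA lerDl addr_ge0// sumr_ge0// => E' _.
  by case: (CeP E').
pose M : R := #|{: V * B + Ed * (B * B)}|%:R.
pose m : R := #|V|%:R + #|Ed|%:R.
have M0 : 0 <= M by []. 
have m0 : 0 <= m by rewrite addr_ge0.
(* The summand 1 avoids a division by 0; only C * m * M * eta <= eps and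
   C * M * eps1 <= eps matter. *)
pose eta := eps / (C * m * M + 1); pose eps1 := eps / (C * M + 1).
have eta0 : 0 < eta by rewrite divr_gt0// ltr_wpDl// !mulr_ge0.
have eps10 : 0 < eps1 by rewrite divr_gt0// ltr_wpDl// !mulr_ge0.
have Ceta : C * m * M * eta <= eps.
  rewrite /eta mulrCA ler_piMr ?(ltW eps0)// ler_pdivrMr ?mul1r ?lerDl//.
  by rewrite ltr_wpDl// !mulr_ge0.
have Ceps1 : C * M * eps1 <= eps.
  rewrite /eps1 mulrCA ler_piMr ?(ltW eps0)// ler_pdivrMr ?mul1r ?lerDl//.
  by rewrite ltr_wpDl// !mulr_ge0.
have [f [g1 [g2 [F [g12 dv de fv fe]]]]] := local_events eps10.
have [K [kap [n [sigma [y]]]]] :=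
  finite_model g12 dv de eta0 eps0.
pose tl := edge_tail u1 (K := K); pose hd := edge_head u1 u2 kap.
pose ep := edge_pairing tl hd sigma y; rewrite /= -/tl -/hd -/ep.
move=> [K0 n0 kap_inj dev cnt].
pose Dv va : R := `|entropy (freq R (y va)) - Hv va.1|.
pose De (Ea : Ed * K) : R := `|entropy (freq R (ep Ea)) - He Ea.1|.
have Dv0 va : 0 <= Dv va by exact: normr_ge0.
have De0 Ea : 0 <= De Ea by exact: normr_ge0.
have DvP : \sum_va Dv va <= #|{: V * K}|%:R * eps + C * (\sum_va \sum_b
    `|freq R (y va) b - fine (nu (vertex_event f (va.1,
      b)))| + (#|{: V * K}| * #|B|)%:R * eps1).
  apply: (@entropies_close _ _ _ (fun va => freq R (y va))
    (fun va => vertex_law mu (vlift va.1))) => // va.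
  have [_ /(_ _ (freq01 R (y va))) h] := CvP va.1.
  by apply: le_trans h _; rewrite lerD2l ler_wpM2r ?CvC// sumr_ge0.
have DeP : \sum_Ea De Ea <= #|{: Ed * K}|%:R * eps + C * (\sum_Ea \sum_bc
    `|freq R (ep Ea) bc - fine (nu (edge_event u1 u2 g1 g2 f (Ea.1, bc)))| +
    (#|{: Ed * K}| * #|{: B * B}|)%:R * eps1).
  apply: (@entropies_close _ _ _ (fun Ea => freq R (ep Ea))
    (fun Ea => edge_law mu (u1 Ea.1) (u2 Ea.1))) => // Ea.
  have [_ /(_ _ (freq01 R (ep Ea))) h] := CeP Ea.1.
  by apply: le_trans h _; rewrite lerD2l ler_wpM2r ?CeC// sumr_ge0.
pose k : R := #|K|%:R.
have k0 : 0 < k by rewrite ltr0n.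
have DD : \sum_va Dv va + \sum_Ea De Ea <= k * ((m + 2) * eps).
  apply: le_trans (lerD DvP DeP) _.
  move: dev; set S1 := \sum_va _; set S2 := \sum_Ea _ => dev.
  have cM : M = #|V|%:R * #|B|%:R + #|Ed|%:R * #|{: B * B}|%:R.
    by rewrite /M card_sum !card_prod natrD !natrM.
  have h1 : C * (S1 + S2) <= k * eps.
    apply: le_trans (ler_wpM2l C0 dev) _.
    rewrite card_prod card_sum !natrM natrD -/k -/m -/M.
    have -> : C * (m * k * M * eta) = k * (C * m * M * eta) by ring.
    by rewrite ler_pM2l.
  have h2 : k * (C * M * eps1) <= k * eps by rewrite ler_pM2l.
  have := lerD h1 h2; rewrite cM !card_prod !natrM -/k /m; lra.
have sum_tl : \sum_Ea Dv (tl Ea) <= #|Ed|%:R * \sum_va Dv va.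
  rewrite sum_pair mulr_natl -sumr_const; apply: ler_sum => E _.
  rewrite [leRHS]sum_pair (bigD1 (s E))//= lerDl.
  by apply: sumr_ge0 => v _; apply: sumr_ge0.
have sum_hd : \sum_Ea Dv (hd Ea) <= #|Ed|%:R * \sum_va Dv va.
  rewrite sum_pair mulr_natl -sumr_const; apply: ler_sum => E _.
  rewrite [leRHS]sum_pair (bigD1 (t E))//= [X in _ <= X + _](reindex_inj (kap_inj E)) lerDl.
  by apply: sumr_ge0 => v _; apply: sumr_ge0.
have kX : k * X = \sum_(va : V * K) Hv va.1 + \sum_(Ea : Ed * K) (He Ea.1 - Hv (s Ea.1) -
  Hv (t Ea.1)).
  rewrite !sum_pair /= /X mulrDr !mulr_sumr.
  by congr (_ + _); apply: eq_bigr => i _; rewrite sumr_const mulr_natl.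
have h1 : \sum_va entropy (freq R (y va)) <= \sum_(va : V * K) Hv va.1 + \sum_va Dv va.
  rewrite -big_split; apply: ler_sum => va _ /=; rewrite /Dv -lerBlDl; exact: ler_norm.
(* Each edge also sees the entropies of its two ends. *)
have h2 : \sum_Ea (entropy (freq R (ep Ea)) - entropy (freq R (y (tl Ea))) -
    entropy (freq R (y (hd Ea)))) <=
    \sum_(Ea : Ed * K) (He Ea.1 - Hv (s Ea.1) - Hv (t Ea.1)) +
    (\sum_Ea De Ea + \sum_Ea Dv (tl Ea) + \sum_Ea Dv (hd Ea)).
  rewrite -!big_split; apply: ler_sum => Ea _ /=.
  have a1 := ler_norm (entropy (freq R (ep Ea)) - He Ea.1).
  have a2 := ler_norm (- (entropy (freq R (y (tl Ea))) - Hv (tl Ea).1)).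
  have a3 := ler_norm (- (entropy (freq R (y (hd Ea))) - Hv (hd Ea).1)).
  move: a1 a2 a3; rewrite !normrN -/(De Ea) -/(Dv (tl Ea)) -/(Dv (hd Ea)) /=; lra.
have eps_k : eps <= k * eps by rewrite ler_peMl ?(ltW eps0)// ler1n.
have sDe0 : 0 <= \sum_Ea De Ea by apply: sumr_ge0.
have Ed0 : (0 : R) <= 2 * #|Ed|%:R by rewrite mulr_ge0.
have h3 : 2 * #|Ed|%:R * (\sum_va Dv va) <= 2 * #|Ed|%:R * (k * ((m + 2) * eps)).
  by rewrite ler_wpM2l//; lra.
rewrite -(pmulr_rge0 _ k0) mulrDr.
have -> : k * (c0 * eps) = k * ((m + 2) * eps) + 2 * #|Ed|%:R * (k * ((m + 2) * eps)) + k
  * eps.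
  by rewrite /c0 -/m; ring.
lra.
Qed.

End Core.

Local Close Scope classical_set_scope.

Theorem theorem2 (R : realType) (V : finType) (e : rel V)
    (e_sym : symmetric e) (e_irr : irreflexive e)
    (e_conn : forall x y : V, connect e x y) (o : V)
    (A B : alphabetType) (D : nat) (D_gt0 : (0 < D)%N)
    (psi : potential R (@uadj V e o) A D) (psi_inv : invariant_potential psi)
    (nu : probability (config (ucover e o) A) R)
    (nu_gibbs : is_unique_gibbs psi nu)
    (tau : config (ucover e o) A -> config (ucover e o) B)
    (tau_meas : measurable_fun [set: config (ucover e o) A]%classic tau)
    (tau_equiv : equivariant tau)
    (vlift : V -> ucover e o) (vliftP : forall v, uproj (vlift v) = v)
    (elift : {set V} -> ucover e o * ucover e o)
    (eliftP : forall E : {set V}, E \in edges e ->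
       uadj (elift E).1 (elift E).2 /\
       [set uproj (elift E).1; uproj (elift E).2] = E) :
  let mu := pushforward nu tau in
  \sum_(v : V) ((degree e v)%:R - 1) * entropy (vertex_law mu (vlift v)) <=
  \sum_(E in edges e) entropy (edge_law mu (elift E).1 (elift E).2).
Proof.
set mu := pushforward nu tau; cbv zeta.
pose Ed : finType := {E in edges e}.
pose u1 (E : Ed) := (elift (val E)).1; pose u2 (E : Ed) := (elift (val E)).2.
have u12 E : uadj (u1 E) (u2 E) by have [] := eliftP _ (valP E).
have stE (E : Ed) : [set uproj (u1 E); uproj (u2 E)] = val E by have [] := eliftP _ (valP E).
have st_inj : injective (fun E => (uproj (u1 E), uproj (u2 E))).
  by move=> E E' [s12 t12]; apply: val_inj; rewrite -!stE s12 t12.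
have st_asym E E' : (uproj (u1 E), uproj (u2 E)) <> (uproj (u2 E'), uproj (u1 E')).
  move=> [s12 t12]; have EE' : E = E'.
    by apply: val_inj; rewrite -!stE s12 t12 finset.setUC.
  have [st _] := uadjP e_sym (u12 E').
  by move: st; rewrite -s12 EE' e_irr.
have := oriented_entropy_inequality e_sym e_irr psi_inv nu_gibbs tau_meas tau_equiv vliftP u12 st_inj st_asym.
rewrite -/mu; set h := fun v => entropy (vertex_law mu (vlift v)).
have sumE (k : {set V} -> R) : \sum_(E : Ed) k (val E) = \sum_(E in edges e) k E.
  by rewrite [RHS]big_sub.
rewrite (sumE (fun E => entropy (edge_law mu (elift E).1 (elift E).2) -
  h (uproj (elift E).1) - h (uproj (elift E).2))).
rewrite !sumrB => core.
have hand := handshake h e_sym e_irr (fun E EP => (eliftP _ EP).2).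
rewrite big_split /= in hand.
have -> : \sum_v ((degree e v)%:R - 1) * entropy (vertex_law mu (vlift v)) =
  \sum_v (degree e v)%:R * h v - \sum_v h v.
  by rewrite -sumrB; apply: eq_bigr => v _; rewrite mulrBl mul1r.
lra.
Qed.
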